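(* Consider the $m$-dimensional Nicholson system $$y_i'(t)=-\widetilde d_i(t)\,y_i(t)+\sum_{j=1}^m\widetilde a_{ij}(t)\,y_j(t)+\widetilde\beta_i(t)\,y_i(t-r_i)\,e^{-\widetilde c_i(t)\,y_i(t-r_i)},\quad i=1,\dots,m,$$ with delays $r_i>0$, and assume: (a1) $\widetilde d_i,\widetilde a_{ij},\widetilde c_i,\widetilde\beta_i$ are almost periodic maps on $\mathbb{R}$; (a2) $\widetilde d_i(t)\ge d_0>0$ for all $t\in\mathbb{R}$ and all $i$; (a3) all $\widetilde a_{ij}$ are nonnegative and $\widetilde a_{ii}\equiv0$; (a4) $\widetilde\beta_i(t)>0$ for all $t\in\mathbb{R}$ and all $i$; (a5) $\widetilde c_i(t)\ge c_0>0$ for all $t\in\mathbb{R}$ and all $i$; (a6) $\widetilde d_i(t)-\sum_{j=1}^m\widetilde a_{ji}(t)>0$ for all $t\in\mathbb{R}$ and all $i$. Assume that the system is uniformly persistent at $0$. If it also holds that $$r_i\,\sup\left\{\widetilde\beta_i(t)\,e^{\int_{t-r_i}^t\widetilde d_i(s)\,ds}\,\Big|\,t\in\mathbb{R}\right\}<e\quad\text{for each }1\le i\le m,$$ then there exists a unique positive almost periodic solution of the system which asymptotically attracts every other positive solution; more precisely, it attracts (the difference tends to $0$ as $t\to\infty$) every other solution $y(t,\varphi)$ with initial value $\varphi\ge0$ such that $\varphi(0)\gg0$.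
   Context: $X=C([-r_1,0])\times\cdots\times C([-r_m,0])$ with the sup-norm. For $\varphi\in X$, $\varphi\ge0$ means all components are nonnegative functions; $\varphi(0)=(\varphi_1(0),\dots,\varphi_m(0))\gg0$ means all its components are positive. For $\varphi\in X$, $y(t,\varphi)$ denotes the solution for $t\ge0$ with $y_i(s,\varphi)=\varphi_i(s)$, $s\in[-r_i,0]$. The Nicholson system is uniformly persistent at $0$ if there exists an $M>0$ such that for every initial map $\varphi\ge0$ with $\varphi(0)\gg0$ there is a time $t_0=t_0(\varphi)$ such that $y_i(t,\varphi)\ge M$ for all $t\ge t_0$ and $i=1,\dots,m$. A continuous $f:\mathbb{R}\to\mathbb{R}$ is almost periodic if for every $\varepsilon>0$ the set $\{s\in\mathbb{R}\mid|f(t+s)-f(t)|<\varepsilon\text{ for all }t\in\mathbb{R}\}$ is relatively dense. *)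

(* Defs.v *)
From HB Require Import structures.
From mathcomp Require Import all_boot all_order all_algebra.
From mathcomp Require Import all_classical all_reals all_analysis.

Set Implicit Arguments.
Unset Strict Implicit.
Unset Printing Implicit Defensive.

Import Order.TTheory GRing.Theory Num.Theory.
Import numFieldNormedType.Exports.

Local Open Scope classical_set_scope.
Local Open Scope ring_scope.

Definition relatively_dense (R : realType) (S : set R) : Prop :=
  exists2 l : R, 0 < l & forall a : R, exists2 s : R, S s & a <= s <= a + l.

Definition almost_periodic (R : realType) (f : R -> R) : Prop :=
  continuous f /\
  forall eps : R, 0 < eps ->
    relatively_dense [set s | forall t : R, `|f (t + s) - f t| < eps].

Definition nicholson_field (R : realType) (m : nat) (r : 'I_m -> R)
    (d : 'I_m -> R -> R) (a : 'I_m -> 'I_m -> R -> R)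
    (beta c : 'I_m -> R -> R) (y : 'I_m -> R -> R) (i : 'I_m) (t : R) : R :=
  - d i t * y i t + \sum_(j < m) a i j t * y j t
  + beta i t * y i (t - r i) * expR (- (c i t * y i (t - r i))).

(* [phi] represents an element of C([-r_1,0]) x ... x C([-r_m,0]); the values
   of [phi i] outside [-r_i,0] are irrelevant here and in all that follows. *)
Definition initial_map (R : realType) (m : nat) (r : 'I_m -> R)
    (phi : 'I_m -> R -> R) : Prop :=
  forall i, {within `[- r i, 0], continuous (phi i)}.

(* phi >= 0 and phi(0) >> 0. *)
Definition admissible_initial_map (R : realType) (m : nat) (r : 'I_m -> R)
    (phi : 'I_m -> R -> R) : Prop :=
  [/\ initial_map r phi,
      forall i (s : R), - r i <= s <= 0 -> 0 <= phi i s
    & forall i, 0 < phi i 0].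

(* [y] is y(., phi); the values of [y i] to the left of -r_i are irrelevant.
   The equation is required for t > 0; at t = 0 it holds for the right
   derivative by continuity of [y] and of the coefficients. *)
Definition nicholson_solution_from (R : realType) (m : nat) (r : 'I_m -> R)
    (d : 'I_m -> R -> R) (a : 'I_m -> 'I_m -> R -> R)
    (beta c : 'I_m -> R -> R) (phi y : 'I_m -> R -> R) : Prop :=
  [/\ forall i (s : R), - r i <= s <= 0 -> y i s = phi i s,
      forall i, {within `[- r i, +oo[, continuous (y i)}
    & forall i (t : R), 0 < t ->
        is_derive t 1 (y i) (nicholson_field r d a beta c y i t)].

Definition nicholson_entire_solution (R : realType) (m : nat) (r : 'I_m -> R)
    (d : 'I_m -> R -> R) (a : 'I_m -> 'I_m -> R -> R)
    (beta c : 'I_m -> R -> R) (y : 'I_m -> R -> R) : Prop :=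
  forall i (t : R), is_derive t 1 (y i) (nicholson_field r d a beta c y i t).

Definition positive_almost_periodic_solution (R : realType) (m : nat)
    (r : 'I_m -> R) (d : 'I_m -> R -> R) (a : 'I_m -> 'I_m -> R -> R)
    (beta c : 'I_m -> R -> R) (y : 'I_m -> R -> R) : Prop :=
  [/\ nicholson_entire_solution r d a beta c y,
      forall i, almost_periodic (y i)
    & forall i (t : R), 0 < y i t].

Definition uniformly_persistent_at_0 (R : realType) (m : nat) (r : 'I_m -> R)
    (d : 'I_m -> R -> R) (a : 'I_m -> 'I_m -> R -> R)
    (beta c : 'I_m -> R -> R) : Prop :=
  exists2 M : R, 0 < M &
    forall phi : 'I_m -> R -> R, admissible_initial_map r phi ->
    forall y : 'I_m -> R -> R, nicholson_solution_from r d a beta c phi y ->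
    exists t0 : R, forall (t : R) (i : 'I_m), t0 <= t -> M <= y i t.

(* Main.v *)
(** Monotonicity for the exponential ordering and sublinearity.  Since the slope
    of x exp(-c x) is at least -e^-2, the bound r_i sup(beta_i e^(int d_i)) < e
    is exactly what makes the system monotone for the order "w >= 0 and
    w_i' + (d_i + 1/r_i) w_i >= 0", the weight d_i + 1/r_i being the optimal one.
    If y and z are solutions with values in [M, K] and y dominates lam z in this
    order, with lam < 1, then strict sublinearity of x exp(-c x) yields a gain
    beta_i * const in the differential inequality for y - lam z.  As beta_i is
    almost periodic and positive, the gain is effective on recurrent time windows,
    and lam can be increased by a fixed amount after a fixed time.  The argument
    tolerates small errors in the equation, so two approximate solutions end up
    uniformly close.  Applied to a solution and its translate by a common
    almost period of the coefficients, this shows that every solution is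
    asymptotically almost periodic, with an almost periodic limit; applied to
    exact solutions, it gives attraction, and hence uniqueness. *)

(* Why e appears: with a weight d_i + mu, the delayed term is absorbed as soon as beta_i exp(int
   d_i) <= mu exp(2 - mu r_i), and the right side is largest at mu = 1/r_i, where it equals e/r_i.
   The strict inequality leaves a slack [eta]. It is this slack, multiplied by the size of y - lam
   z, that keeps the derivative half of the order strict at times when beta_i is small; the gain
   itself is only available on windows, because a positive almost periodic function may have infimum
   0. The column surplus d_i - sum_j a_ji has the same defect, so the upper bound on solutions also
   comes from decay on recurrent windows. Persistence gives only a lower bound, and only for
   solutions that exist, so one solution has to be constructed. Neither the hull of the equation nor
   compactness in the space of solutions is used: a translate by an almost period solves the same
   equation up to a small defect, and the constants of the comparison do not depend on the starting
   time. The limit of translates is obtained from a Cauchy argument, and it solves the equation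
   because its increments agree with those of a primitive of the field. *)
Require Import Defs.
From mathcomp Require Import all_boot all_order all_algebra.
From mathcomp Require Import all_classical all_reals all_analysis.
From mathcomp Require Import ring lra.

Import Order.TTheory GRing.Theory Num.Theory.
Import numFieldNormedType.Exports.

Local Open Scope classical_set_scope.
Local Open Scope ring_scope.

(** * Derivatives, primitives and uniform continuity on the real line *)

Section real_calculus.
Context {R : realType}.
Implicit Types (f df g : R -> R) (a b x l : R).

Lemma is_derive_continuous f x l : is_derive x 1 f l -> {for x, continuous f}.
Proof. by case=> df _; apply/differentiable_continuous/derivable1_diffP. Qed.

Lemma nondecreasing_of_derive f df a b : a <= b ->
  {within `[a, b], continuous f} ->
  (forall x, a < x < b -> is_derive x 1 f (df x)) ->
  (forall x, a < x < b -> 0 <= df x) -> f a <= f b.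
Proof.
rewrite le_eqVlt => /predU1P[->//|ab] cf dfx df0.
have dfi x : x \in `]a, b[ -> is_derive x 1 f (df x).
  by rewrite in_itv /= => ?; apply: dfx.
have [x] := MVT ab dfi cf.
rewrite in_itv /= => xab fE; rewrite -subr_ge0 fE mulr_ge0 ?df0//.
by rewrite subr_ge0 ltW.
Qed.

Lemma nondecreasing_of_derive_cc f df a b : a <= b ->
  (forall x, a <= x <= b -> is_derive x 1 f (df x)) ->
  (forall x, a <= x <= b -> 0 <= df x) -> f a <= f b.
Proof.
move=> ab dfx df0; apply: (@nondecreasing_of_derive f df) => //.
- apply: derivable_within_continuous => x; rewrite in_itv /= => xab.
  by case: (dfx _ xab).
- by move=> x /andP[/ltW ? /ltW ?]; apply: dfx; apply/andP.
- by move=> x /andP[/ltW ? /ltW ?]; apply: df0; apply/andP.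
Qed.

Lemma is_derive_scale f k x l :
  is_derive x 1 f l -> is_derive x 1 (fun s => k * f s) (k * l).
Proof. by move=> fl; apply: is_deriveZ. Qed.

Lemma is_derive_sub f g x l l' : is_derive x 1 f l -> is_derive x 1 g l' ->
  is_derive x 1 (fun s => f s - g s) (l - l').
Proof. by move=> fl gl; apply: is_deriveB. Qed.

Lemma is_derive_add f g x l l' : is_derive x 1 f l -> is_derive x 1 g l' ->
  is_derive x 1 (fun s => f s + g s) (l + l').
Proof. by move=> fl gl; apply: is_deriveD. Qed.

Lemma is_derive_mul f g x l l' : is_derive x 1 f l -> is_derive x 1 g l' ->
  is_derive x 1 (fun s => f s * g s) (l * g x + f x * l').
Proof.
move=> fl gl; apply: is_derive_eq (is_deriveM fl gl) _.
by rewrite /GRing.scale /= addrC [g x * l]mulrC.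
Qed.

Lemma is_derive_comp f g x l l' : is_derive x 1 f l -> is_derive (f x) 1 g l' ->
  is_derive x 1 (fun s => g (f s)) (l' * l).
Proof.
move=> [df <-] [dg <-]; apply: DeriveDef.
  apply/derivable1_diffP; apply: differentiable_comp; exact/derivable1_diffP.
by rewrite -derive1E (derive1_comp df dg) !derive1E.
Qed.

Lemma is_derive_linear k x : is_derive x 1 (fun s : R => k * s) k.
Proof.
apply: is_derive_eq (@is_derive_mul (fun=> k) id x 0 1 _ _) _.
by rewrite mul0r add0r mulr1.
Qed.

Lemma is_derive_comp_shift f s x l :
  is_derive (x + s) 1 f l -> is_derive x 1 (fun t => f (t + s)) l.
Proof.
move=> fl; rewrite -[l]mulr1.
by apply: (@is_derive_comp (shift s) f x 1 l) => //; exact: is_derive_shift.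
Qed.

(** The integral from -N is differentiable only to the right of -N, whence the half-line.
    Subtracting its value at 0 makes the primitives for different N agree on overlaps. *)
Lemma primitive_on_halfline (g : R -> R) (N : R) : continuous g -> 0 < N ->
  exists G : R -> R, G 0 = 0 /\ forall x, - N < x -> is_derive x 1 G (g x).
Proof.
move=> cg N0.
pose F x := (\int[lebesgue_measure]_(t in `[(- N)%R, x]) g t)%R.
exists (fun x => F x - F 0); split; first by rewrite subrr.
move=> x Nx; rewrite -[g x]subr0.
apply: (@is_derive_sub F (fun=> F 0)).
have [| |] := @continuous_FTC1_closed R g (- N) x (x + 1) _ _ Nx (cg x).
- by rewrite ltrDl.
- apply: continuous_compact_integrable; first exact: segment_compact.
  exact: continuous_subspaceT.
- by move=> dF <-; rewrite derive1E; apply/derivableP.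
Qed.

Lemma eq_of_derive (f g h : R -> R) a b : a <= b ->
  (forall x, a <= x <= b -> is_derive x 1 f (h x)) ->
  (forall x, a <= x <= b -> is_derive x 1 g (h x)) -> f b - f a = g b - g a.
Proof.
move=> ab fh gh; apply/le_anti/andP; split.
- rewrite -subr_ge0 (_ : _ - _ = (g b - f b) - (g a - f a)); last by ring.
  rewrite subr_ge0; apply: (@nondecreasing_of_derive_cc
    (fun x => g x - f x) (fun x => h x - h x)) => // x xab.
    by apply: is_derive_sub; [apply: gh|apply: fh].
  by rewrite subrr.
- rewrite -subr_ge0 (_ : _ - _ = (f b - g b) - (f a - g a)); last by ring.
  rewrite subr_ge0; apply: (@nondecreasing_of_derive_cc
    (fun x => f x - g x) (fun x => h x - h x)) => // x xab.
    by apply: is_derive_sub; [apply: fh|apply: gh].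
  by rewrite subrr.
Qed.

Lemma primitive_exists (g : R -> R) : continuous g ->
  exists G : R -> R, G 0 = 0 /\ forall x, is_derive x 1 G (g x).
Proof.
move=> cg.
have [F HF] : {F : R -> R -> R & forall N : R, 0 < N ->
    F N 0 = 0 /\ forall x, - N < x -> is_derive x 1 (F N) (g x)}.
  apply: (@choice R (R -> R) (fun N G => 0 < N -> G 0 = 0 /\
    forall x, - N < x -> is_derive x 1 G (g x))) => N.
  have [N0|/negP N0] := boolP (0 < N); last by exists (fun=> 0).
  by have [G ?] := @primitive_on_halfline g N cg N0; exists G.
have FE N M x : 0 < N -> 0 < M -> - N < x -> - M < x -> F N x = F M x.
  move=> N0 M0 Nx Mx; have [FN0 FN] := HF _ N0; have [FM0 FM] := HF _ M0.
  have [x0|/ltW x0] := leP 0 x.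
    have : F N x - F N 0 = F M x - F M 0.
      by apply: (@eq_of_derive _ _ g) => // y /andP[y0 _];
        [apply: FN|apply: FM]; lra.
    by rewrite FN0 FM0 !subr0.
  have : F N 0 - F N x = F M 0 - F M x.
    by apply: (@eq_of_derive _ _ g) => // y /andP[y0 _];
      [apply: FN|apply: FM]; lra.
  by rewrite FN0 FM0 !sub0r => /oppr_inj.
(* The index varies with x; near a given x all these functions coincide with the one of fixed index
   |x| + 2. *)
exists (fun x => F (`|x| + 1) x); split.
  by rewrite normr0 add0r; have [] := HF 1 ltr01.
move=> x; have x2 : 0 < `|x| + 2 by have := normr_ge0 x; lra.
have [_ Fx] := HF _ x2.
have := Fx x _; have := ler_norm (- x); rewrite normrN => xx /(_ ltac:(lra)).
apply: near_eq_is_derive; near=> y.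
have xy : `|x - y| < 1 by near: y; apply/nbhs_normP; exists 1 => //=.
have := ler_norm (- y); have := ler_normD x (y - x); rewrite normrN.
have := normr_ge0 x; have := normr_ge0 y.
rewrite subrKC distrC => *; apply: FE; lra.
Unshelve. all: by end_near. Qed.

(** Only x is confined to the segment. This matters below, where a translation brings x into the
    segment but may leave y outside. *)
Lemma uniformly_continuous_segment (f : R -> R) a b eps : continuous f -> 0 < eps ->
  exists2 del : R, 0 < del &
    forall x y, a <= x <= b -> `|y - x| < del -> `|f y - f x| < eps.
Proof.
move=> cf e0.
have := @segment_compact R a b; move/compact_near_coveringP.
move=> /(_ _ (0^'+) (fun del x => forall y, `|y - x| < del -> `|f y - f x| < eps)).
case.
  move=> x _.
  have /cvgrPdist_lt/(_ (eps/2)) := cf x; rewrite divr_gt0// => /(_ isT).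
  move=> /nbhs_ballP[d /= d0 fd].
  exists (ball x (d/2), [set e | e < d / 2]).
    split => /=; first by apply: nbhsx_ballx; rewrite divr_gt0.
    by apply: nbhs_right_lt; rewrite divr_gt0.
  move=> [x' d'] /= [xx' dd'] y yx'.
  have xd: `|x - x'| < d / 2 by [].
  have h1 : `|f x - f x'| < eps / 2 by apply: fd; rewrite /ball /=; lra.
  have h2 : `|f x - f y| < eps / 2.
    apply: fd; rewrite /ball /=.
    by have := ler_distD x' x y; rewrite (distrC x' y); lra.
  by have := ler_distD (f x) (f y) (f x'); rewrite (distrC (f y) (f x)); lra.
move=> d /= d0 H; exists (d / 2); first by rewrite divr_gt0.
move=> x y xab; apply: (H (d/2)) => //=; rewrite ?in_itv//= ?divr_gt0//.
by rewrite sub0r normrN gtr0_norm; lra.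
Qed.
End real_calculus.

(** * Almost periodic functions and common almost periods *)

Section almost_periodicity.
Context {R : realType}.

Definition common_period {I : Type} (f : I -> R -> R) (eps s : R) : Prop :=
  forall i t, `|f i (t + s) - f i t| < eps.

(** An almost period moves any t into [0, l], where compactness applies; the same device gives
    uniform continuity next. *)
Lemma almost_periodic_bounded (f : R -> R) : almost_periodic f ->
  exists2 B : R, 0 < B & forall t, `|f t| <= B.
Proof.
move=> [cf /(_ _ ltr01) [l l0 fl]].
have [c _ cmax] : exists2 c, c \in `[0, l] &
    forall t, t \in `[0, l] -> `|f t| <= `|f c|.
  apply: (@EVT_max _ (fun t => `|f t|)); first exact: ltW.
  apply: continuous_subspaceT => x.
  by apply: continuous_comp; [exact: cf|exact: norm_continuous].
exists (`|f c| + 1) => [|t]; first by rewrite ltr_pwDr.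
have [s /= fs sl] := fl (- t).
have := cmax (t + s); rewrite in_itv /= => /(_ ltac:(lra)).
have := fs t; rewrite distrC => h1 h2.
have := ler_normD (f t - f (t + s)) (f (t + s)); rewrite subrK; lra.
Qed.

Lemma almost_periodic_uniformly_continuous (f : R -> R) (eps : R) :
  almost_periodic f -> 0 < eps ->
  exists2 del : R, 0 < del & forall x y, `|y - x| < del -> `|f y - f x| < eps.
Proof.
move=> [cf apf] e0; have e3 : 0 < eps / 3 by rewrite divr_gt0.
have [l l0 fl] := apf _ e3.
have [del del0 fdel] := @uniformly_continuous_segment R f 0 l _ cf e3.
exists del => // x y xy.
have [s /= fs sl] := fl (- x).
have h1 : `|f (y + s) - f (x + s)| < eps / 3.
  by apply: fdel; [lra|rewrite (_ : _ - _ = y - x)//; ring].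
have h2 := fs x; have h3 := fs y; rewrite distrC in h3.
have := ler_distD (f (y + s)) (f y) (f x).
have := ler_distD (f (x + s)) (f (y + s)) (f x); lra.
Qed.

(** Bochner's total boundedness of the set of translates, in the form of a finite colouring. Up to
    an almost period, s may be replaced by some u s in [0, l], and uniform continuity allows [0, l]
    to be cut into cells of length [del]. *)
Lemma almost_periodic_translates_precompact (f : R -> R) (eps : R) :
  almost_periodic f -> 0 < eps ->
  exists (N : nat) (k : R -> nat), (forall s, (k s <= N)%N) /\
    forall s s', k s = k s' -> forall t, `|f (t + s) - f (t + s')| < eps.
Proof.
move=> apf e0; have e4 : 0 < eps / 4 by rewrite divr_gt0.
have [del del0 fdel] := almost_periodic_uniformly_continuous f (eps / 4) apf e4.
have [_ /(_ _ e4) [l l0 fl]] := apf.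
have [u Hu] : {u : R -> R & forall s, 0 <= u s <= l /\
    forall t, `|f (t + (s - u s)) - f t| < eps / 4}.
  apply: (@choice R R (fun s u => 0 <= u <= l /\
    forall t, `|f (t + (s - u)) - f t| < eps / 4)) => s.
  have [p /= fp pl] := fl (s - l).
  exists (s - p); split; first lra.
  by move=> t; rewrite (_ : s - (s - p) = p)//; ring.
exists (Num.truncn (l / del)), (fun s => Num.truncn (u s / del)); split.
  move=> s; apply: le_truncn; rewrite ler_pM2r ?invr_gt0//.
  by have [/andP[_ ->]] := Hu s.
move=> s s' kss' t.
have [/andP[u0 ul] us] := Hu s; have [/andP[u'0 u'l] us'] := Hu s'.
have /andP[a1 a2] : (Num.truncn (u s / del))%:R <= u s / del <
    (Num.truncn (u s / del)).+1%:R by apply: truncn_itv; rewrite divr_ge0// ltW.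
have /andP[b1 b2] : (Num.truncn (u s' / del))%:R <= u s' / del <
    (Num.truncn (u s' / del)).+1%:R by apply: truncn_itv; rewrite divr_ge0// ltW.
rewrite kss' -natr1 in a1 a2; rewrite -natr1 in b2.
have uu' : `|u s - u s'| < del.
  have : `|u s / del - u s' / del| < 1 by rewrite ltr_norml; lra.
  rewrite -mulrBl normrM [`|del^-1|]gtr0_norm ?invr_gt0//.
  by rewrite ltr_pdivrMr// mul1r.
have h1 := us (t + u s); have h2 := us' (t + u s').
rewrite (_ : t + u s + (s - u s) = t + s) in h1; last by ring.
rewrite (_ : t + u s' + (s' - u s') = t + s') in h2; last by ring.
have h3 : `|f (t + u s) - f (t + u s')| < eps / 4.
  by apply: fdel; rewrite (_ : _ - _ = u s - u s')//; ring.
have := ler_distD (f (t + u s)) (f (t + s)) (f (t + s')).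
have := ler_distD (f (t + u s')) (f (t + u s)) (f (t + s')).
rewrite (distrC (f (t + u s')) (f (t + s'))); lra.
Qed.

(* Pigeonhole: each translate falls into one of finitely many cells, and the
   difference of two elements of the same cell is a common period. *)
Lemma common_periods_relatively_dense {I : finType} (f : I -> R -> R) (eps : R) :
  (forall i, almost_periodic (f i)) -> 0 < eps ->
  relatively_dense [set s | common_period f eps s].
Proof.
move=> apf e0.
have [N HN] := choice (fun i => almost_periodic_translates_precompact _ _ (apf i) e0).
have [k Hk] := choice HN.
pose K := (\max_i N i)%N.
pose P s : {ffun I -> 'I_K.+1} := [ffun i => inord (k i s)].
have PE s s' : P s = P s' -> forall i, k i s = k i s'.
  move=> /ffunP PP i; have := PP i; rewrite !ffunE => /(congr1 val) /=.
  have kK x : (k i x < K.+1)%N.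
    by rewrite ltnS; apply: leq_trans (leq_bigmax i); have [] := Hk i.
  by rewrite !inordK.
have [rep repP] : {rep : {ffun I -> 'I_K.+1} -> R &
    forall x, forall s, P s = x -> P (rep x) = x}.
  apply: (@choice _ _ (fun x q => forall s, P s = x -> P q = x)) => x.
  have [[s sx]|nx] := pselect (exists s, P s = x); first by exists s.
  by exists 0 => s sx; case: nx; exists s.
(* [L] bounds all representatives at once, so s0 minus its representative lies in [a, a + 2L]. The
   extra 1 in the length only ensures that it is positive. *)
pose L := \sum_x `|rep x|.
have L0 : 0 <= L by apply: sumr_ge0.
exists (2 * L + 1); first lra.
move=> a; pose s0 := a + L.
have repL : `|rep (P s0)| <= L.
  by rewrite /L (bigD1 (P s0))//= lerDl sumr_ge0.
exists (s0 - rep (P s0)) => /=; last first.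
  by move: repL; rewrite ler_norml /s0; lra.
move=> i t; have [_ /(_ s0 (rep (P s0)))] := Hk i.
have /PE : P s0 = P (rep (P s0)) by rewrite (repP _ s0).
move=> /(_ i) kk /(_ kk (t - rep (P s0))).
by rewrite subrK (_ : t - _ + s0 = t + (s0 - rep (P s0)))//; ring.
Qed.

(** Common almost periods occur arbitrarily far to the right, so the difference at any t is
    approximated by its values near +oo. *)
Lemma almost_periodic_unique_asymptotic (y z : R -> R) :
  almost_periodic y -> almost_periodic z ->
  y t - z t @[t --> +oo] --> (0 : R) -> y = z.
Proof.
move=> apy apz yz; apply/funext => t; apply/eqP; rewrite -subr_eq0 -normr_le0.
apply/ler_addgt0Pr => eps e0; rewrite add0r.
have e4 : 0 < eps / 4 by rewrite divr_gt0.
have [T [_ HT]] : \forall t \near +oo, `|0 - (y t - z t)| < eps / 4.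
  by move/cvgrPdist_lt : yz; apply.
have [|l l0 hl] := @common_periods_relatively_dense bool
  (fun b => if b then y else z) (eps / 4) _ e4; first by case.
have [s /= hs sT] := hl (T - t + 1).
have h1 := hs true t; have h2 := hs false t.
have h3 := HT (t + s) ltac:(lra); rewrite sub0r normrN in h3.
rewrite /= in h1 h2; rewrite distrC in h1.
have := ler_distD (y (t + s)) (y t) (z t).
have := ler_distD (z (t + s)) (y (t + s)) (z t); lra.
Qed.
End almost_periodicity.

(** * Global solvability of retarded equations by a weighted Picard iteration *)

Section picard.
Context {R : realType}.

Lemma cauchy_limit (u : nat -> R) :
  (forall eps : R, 0 < eps ->
    exists N, forall n m, (N <= n)%N -> (N <= m)%N -> `|u n - u m| <= eps) ->
  exists l : R, forall eps : R, 0 < eps ->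
    exists N, forall n, (N <= n)%N -> `|u n - l| <= eps.
Proof.
move=> cu.
have : cvg (u @ \oo).
  apply/cauchy_cvgP/cauchy_exP => eps e0.
  have e2 : 0 < eps / 2 by rewrite divr_gt0.
  have [N HN] := cu _ e2; exists (u N); exists N => // n /= Nn.
  by rewrite /ball /=; have := HN N n (leqnn N) Nn; lra.
move=> /cvg_ex [/= l ul]; exists l => eps e0.
move/cvgrPdist_le : ul => /(_ _ e0) [N _ HN]; exists N => n /= Nn.
by rewrite distrC; apply: HN.
Qed.

Lemma geometric_small (A eps : R) : 0 < eps -> exists N : nat, A * 2^-1 ^+ N <= eps.
Proof.
move=> e0; have /cvgrPdist_le /(_ _ e0) [N _ HN] :
    (fun n => A * 2^-1 ^+ n) @ \oo --> (0 : R).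
  rewrite -[X in _ --> X](mulr0 A); apply: cvgMr.
  by apply: cvg_expr; rewrite ger0_norm//; lra.
exists N; have := HN N (leqnn N); rewrite sub0r normrN; apply: le_trans.
exact: ler_norm.
Qed.

Lemma geometric_limit (u : nat -> R) (A : R) :
  (forall n, `|u n.+1 - u n| <= A * 2^-1 ^+ n) ->
  exists l, forall n, `|u n - l| <= 2 * A * 2^-1 ^+ n.
Proof.
move=> uA.
have A0 : 0 <= A by have := uA 0%N; rewrite expr0 mulr1; apply: le_trans.
have uu n k : `|u (n + k)%N - u n| <= 2 * A * 2^-1 ^+ n - 2 * A * 2^-1 ^+ (n + k).
  elim: k => [|k IH]; first by rewrite addn0 !subrr normr0.
  rewrite addnS; have := uA (n + k)%N.
  have := ler_distD (u (n + k)%N) (u (n + k).+1) (u n).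
  rewrite [X in _ - 2 * A * X]exprS; lra.
have p0 n : 0 <= A * 2^-1 ^+ n by rewrite mulr_ge0// exprn_ge0.
have [|l ul] := cauchy_limit u.
  move=> eps e0.
  have [N HN] : exists N, 4 * A * 2^-1 ^+ N <= eps by apply: geometric_small.
  exists N => n m Nn Nm.
  have := uu N (n - N)%N; have := uu N (m - N)%N; rewrite !subnKC//.
  have := ler_distD (u N) (u n) (u m); rewrite (distrC (u N)).
  have := p0 n; have := p0 m; lra.
exists l => n; apply/ler_addgt0Pr => eps e0.
have [N HN] := ul _ e0.
have := uu n N; have := HN (n + N)%N (leq_addl _ _).
have := ler_distD (u (n + N)%N) (u n) l; rewrite (distrC (u n) (u (n + N)%N)).
have := p0 (n + N)%N; lra.
Qed.

(** Integration gains a factor 1/kap in the Bielecki norm, the supremum of |G t| exp(-kap t). Hence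
    the Picard operator contracts on the whole half-line at once, with no continuation argument. *)
Lemma primitive_exp_bound (G g : R -> R) (C kap : R) : G 0 = 0 ->
  (forall t : R, is_derive t 1 G (g t)) ->
  (forall t, 0 <= t -> `|g t| <= C * (kap * expR (kap * t))) -> 0 <= C ->
  forall t, 0 <= t -> `|G t| <= C * expR (kap * t).
Proof.
move=> G0 dG gb C0 t t0.
have dE (x : R) : is_derive x 1 (fun s => C * expR (kap * s))
    (C * (kap * expR (kap * x))).
  apply: is_derive_scale; rewrite mulrC.
  apply: (@is_derive_comp _ (fun s => kap * s) expR x kap).
  exact: is_derive_linear.
have pos x : 0 <= x -> 0 <= C * (kap * expR (kap * x)) - g x /\
    0 <= C * (kap * expR (kap * x)) + g x.
  by move=> /gb; rewrite ler_norml; lra.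
rewrite ler_norml; apply/andP; split.
  suff : C * expR (kap * 0) + G 0 <= C * expR (kap * t) + G t.
    by rewrite mulr0 expR0 G0; lra.
  apply: (@nondecreasing_of_derive_cc _ (fun s => C * expR (kap * s) + G s)
    (fun s => C * (kap * expR (kap * s)) + g s)) => // x /andP[x0 _].
  by have [] := pos x x0.
suff : C * expR (kap * 0) - G 0 <= C * expR (kap * t) - G t.
  by rewrite mulr0 expR0 G0; lra.
apply: (@nondecreasing_of_derive_cc _ (fun s => C * expR (kap * s) - G s)
  (fun s => C * (kap * expR (kap * s)) - g s)) => // x /andP[x0 _].
by have [] := pos x x0.
Qed.

Lemma continuous_of_exp_uniform_limit (u : nat -> R -> R) (y : R -> R) (A kap : R) :
  0 <= kap -> (forall n, continuous (u n)) ->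
  (forall n t, `|u n t - y t| <= A * 2^-1 ^+ n * expR (kap * t)) -> continuous y.
Proof.
move=> kap0 cu uy t; apply/cvgrPdist_le => eps e0.
have e3 : 0 < eps / 3 by rewrite divr_gt0.
have A0 : 0 <= A * expR (kap * t).
  by have := uy 0%N t; rewrite expr0 mulr1; apply: le_trans.
have {}A0 : 0 <= A by rewrite pmulr_lge0// expR_gt0 in A0.
pose E := expR (kap * (t + 1)).
have [N HN] : exists N, A * E * 2^-1 ^+ N <= eps / 3 by apply: geometric_small.
have close s : s <= t + 1 -> `|u N s - y s| <= eps / 3.
  move=> st; apply: le_trans (uy N s) _; apply: le_trans HN.
  rewrite mulrAC; apply: ler_wpM2r; first by rewrite exprn_ge0.
  by rewrite ler_wpM2l// ler_expR ler_wpM2l.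
near=> s.
have h1 : `|u N t - u N s| <= eps / 3.
  by near: s; have /cvgrPdist_le := cu N t; apply.
have h2 := close t ltac:(lra).
have h3 : s <= t + 1.
  have : `|t - s| < 1 by near: s; apply/nbhs_normP; exists 1 => //=.
  by rewrite ltr_norml; lra.
have h4 := close s h3.
have := ler_distD (u N t) (y t) (y s); have := ler_distD (u N s) (u N t) (y s).
rewrite (distrC (y t) (u N t)); lra.
Unshelve. all: by end_near. Qed.

(* [F] is a causal functional: the exponentially weighted Lipschitz condition
   covers retarded arguments since the weight is nondecreasing. *)
Lemma picard_retarded {I : Type} (F : (I -> R -> R) -> I -> R -> R)
    (x0 : I -> R) (L B : R) : 0 < L ->
  (forall y, (forall i, continuous (y i)) -> forall i, continuous (F y i)) ->
  (forall y z C kap, 0 <= C -> 0 <= kap ->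
    (forall j s, `|y j s - z j s| <= C * expR (kap * s)) ->
    forall i t, `|F y i t - F z i t| <= L * (C * expR (kap * t))) ->
  (forall i t, `|F (fun j _ => x0 j) i t| <= B) ->
  exists y : I -> R -> R, [/\ forall i, continuous (y i),
    forall i t, t <= 0 -> y i t = x0 i &
    forall i (t : R), 0 < t -> is_derive t 1 (y i) (F y i t)].
Proof.
move=> L0 Fcont Flip Fbound.
have [P HP] : {P : (R -> R) -> R -> R & forall g, continuous g ->
    P g 0 = 0 /\ forall x : R, is_derive x 1 (P g) (g x)}.
  apply: (@choice (R -> R) (R -> R) (fun g G => continuous g ->
    G 0 = 0 /\ forall x : R, is_derive x 1 G (g x))) => g.
  have [cg|ncg] := pselect (continuous g); last by exists g.
  by have [G ?] := primitive_exists g cg; exists G.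
have P0 g : continuous g -> P g 0 = 0 by move=> /HP[].
have dP g : continuous g -> forall x : R, is_derive x 1 (P g) (g x) by move=> /HP[].
have cP g : continuous g -> continuous (P g).
  by move=> cg x; apply: is_derive_continuous (dP _ cg x).
(* The maximum freezes the iterates at [x0] for t <= 0, which encodes the constant history. *)
pose T (y : I -> R -> R) i t := x0 i + P (F y i) (Num.max t 0).
have cT y : (forall i, continuous (y i)) -> forall i, continuous (T y i).
  move=> cy i t; apply: cvgD; first exact: cvg_cst.
  apply: (@continuous_comp _ _ _ (fun s : R => Num.max s 0) (P (F y i))).
    by apply: continuous_max; [exact: cvg_id|exact: cvg_cst].
  by apply: cP; apply: Fcont.
(* With this weight the contraction factor L / kap is 1/2. *)
pose kap := 2 * L; have kap0 : 0 < kap by rewrite mulr_gt0.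
have Tlip y z C : 0 <= C ->
    (forall i, continuous (y i)) -> (forall i, continuous (z i)) ->
    (forall j s, `|y j s - z j s| <= C * expR (kap * s)) ->
    forall i t, `|T y i t - T z i t| <= C / 2 * expR (kap * t).
  move=> C0 cy cz yz i t; rewrite /T.
  have cFy := Fcont _ cy i; have cFz := Fcont _ cz i.
  rewrite opprD addrACA subrr add0r.
  have [t0|t0] := leP 0 t; last first.
    by rewrite !P0// subrr normr0 !mulr_ge0// expR_ge0.
  apply: (@primitive_exp_bound (fun s => P (F y i) s - P (F z i) s)
    (fun s => F y i s - F z i s)) => //.
  - by rewrite !P0// subrr.
  - by move=> s; apply: is_derive_sub; apply: dP.
  - move=> s _; apply: le_trans (Flip _ _ C kap C0 (ltW kap0) yz i s) _.
    by rewrite /kap; lra.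
  - by rewrite divr_ge0.
pose u n := iter n T (fun j _ => x0 j).
have cu n i : continuous (u n i).
  elim: n i => [|n IH] i; first by move=> t; exact: cvg_cst.
  exact: cT.
pose A := `|B| / kap; have A0 : 0 <= A by rewrite divr_ge0// ltW.
have u01 i t : `|u 1%N i t - u 0%N i t| <= A * expR (kap * t).
  rewrite /u /= /T addrAC subrr add0r.
  have cF : continuous (F (fun j _ => x0 j) i).
    by apply: Fcont => j s; exact: cvg_cst.
  have [t0|t0] := leP 0 t; last by rewrite P0// normr0 mulr_ge0// expR_ge0.
  apply: (@primitive_exp_bound _ (F (fun j _ => x0 j) i)) => //; first exact: P0.
    exact: dP.
  move=> s s0; apply: le_trans (Fbound i s) _.
  rewrite mulrA /A divfK ?gt_eqF//.
  apply: le_trans (ler_norm _) _; rewrite ler_peMr//.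
  by rewrite -expR0 ler_expR mulr_ge0// ltW.
have uS n i t : `|u n.+1 i t - u n i t| <= A * 2^-1 ^+ n * expR (kap * t).
  elim: n i t => [|n IH] i t; first by rewrite expr0 mulr1.
  have An : 0 <= A * 2^-1 ^+ n by rewrite mulr_ge0// exprn_ge0.
  have := Tlip _ _ _ An (cu n.+1) (cu n) IH i t.
  by rewrite exprSr mulrA.
have [y Hy] : {y : I * R -> R & forall p n,
    `|u n p.1 p.2 - y p| <= 2 * (A * expR (kap * p.2)) * 2^-1 ^+ n}.
  apply: (@choice (I * R)%type R (fun p l => forall n,
    `|u n p.1 p.2 - l| <= 2 * (A * expR (kap * p.2)) * 2^-1 ^+ n)) => -[i t] /=.
  apply: geometric_limit => n; by rewrite mulrAC.
pose z i t := y (i, t).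
have zu n i t : `|u n i t - z i t| <= 2 * A * 2^-1 ^+ n * expR (kap * t).
  by have := Hy (i, t) n; rewrite mulrA mulrAC.
have cz i : continuous (z i).
  by apply: (@continuous_of_exp_uniform_limit (fun n => u n i) _ (2 * A) kap);
    rewrite ?ltW.
have zT i t : z i t = T z i t.
  apply/eqP; rewrite -subr_eq0 -normr_le0; apply/ler_addgt0Pr => eps e0.
  rewrite add0r.
  have [N HN] : exists N, 4 * A * expR (kap * t) * 2^-1 ^+ N <= eps.
    exact: geometric_small.
  have C0 : 0 <= 2 * A * 2^-1 ^+ N.
    by apply: mulr_ge0; [exact: mulr_ge0|exact: exprn_ge0].
  have h1 := Tlip _ _ _ C0 (cu N) cz (zu N) i t.
  have h2 := zu N.+1 i t.
  have := ler_distD (u N.+1 i t) (z i t) (T z i t).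
  rewrite (distrC (z i t) (u N.+1 i t)); rewrite exprS in h2.
  rewrite -[T (u N)]/(u N.+1) in h1; lra.
exists z; split => // i t t0.
  by rewrite zT /T max_r// P0 ?addr0//; apply: Fcont.
have dx : is_derive t 1 (fun s => x0 i + P (F z i) s) (0 + F z i t).
  by apply: is_derive_add; apply: dP; apply: Fcont.
rewrite add0r in dx; apply: near_eq_is_derive dx.
near=> s.
have st : `|t - s| < t by near: s; apply/nbhs_normP; exists t => //=.
by rewrite zT /T max_l//; move: st; rewrite ltr_norml; lra.
Unshelve. all: by end_near. Qed.
End picard.

(** * Estimates for the nonlinearity x exp(-c x) *)

Section ricker.
Context {R : realType}.
Implicit Types (c x y l : R).

Definition ricker c x : R := x * expR (- (c * x)).

Lemma is_derive_ricker c x :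
  is_derive x 1 (ricker c) ((1 - c * x) * expR (- (c * x))).
Proof.
have dl : is_derive x 1 (fun s => - c * s) (- c) by exact: is_derive_linear.
have de : is_derive x 1 (fun s => expR (- c * s)) (expR (- c * x) * - c).
  exact: (@is_derive_comp _ (fun s => - c * s) expR).
have := @is_derive_mul _ id (fun s => expR (- c * s)) x 1 _ (is_derive_id x 1) de.
rewrite (_ : (fun s : R => id s * expR (- c * s)) = ricker c); last first.
  by apply/funext => s; rewrite /ricker mulNr.
by move=> dr; apply: is_derive_eq dr _; rewrite mulNr; ring.
Qed.

(* The slope of [ricker c] is minimal where [c x = 2]. *)
Lemma ricker_slope c x y : x <= y ->
  - expR (-2) * (y - x) <= ricker c y - ricker c x.
Proof.
move=> xy.
suff : ricker c x + expR (-2) * x <= ricker c y + expR (-2) * y by lra.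
apply: (@nondecreasing_of_derive_cc _ (fun s => ricker c s + expR (-2) * s)
  (fun s => (1 - c * s) * expR (- (c * s)) + expR (-2))) => //.
  move=> s _; apply: is_derive_add; first exact: is_derive_ricker.
  exact: is_derive_linear.
(* exp u >= 1 + u at u = c s - 2, multiplied by exp(-c s), is exactly the lower bound on the
   slope. *)
move=> s _; have := expR_ge1Dx (c * s - 2).
rewrite expRD -[expR (c * s)]invrK -expRN => h.
have p := expR_gt0 (- (c * s)).
have : (1 + (c * s - 2)) * expR (- (c * s)) <= expR (-2).
  have := ler_wpM2r (ltW p) h.
  by rewrite [_^-1 * _]mulrC divfK ?gt_eqF.
lra.
Qed.

Lemma ricker_le_id c x : 0 <= c -> 0 <= x -> ricker c x <= x.
Proof.
move=> c0 x0; rewrite /ricker ler_piMr// -expR0 ler_expR oppr_le0.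
exact: mulr_ge0.
Qed.

Lemma ricker_ge0 c x : 0 <= x -> 0 <= ricker c x.
Proof. by move=> x0; rewrite mulr_ge0// expR_ge0. Qed.

Lemma ricker_le_inv c x : 0 < c -> ricker c x <= c^-1.
Proof.
move=> c0; rewrite /ricker expRN ler_pdivrMr ?expR_gt0//.
rewrite mulrC ler_pdivlMr// mulrC.
by apply: le_trans (expR_ge1Dx _); rewrite lerDr.
Qed.

(** Shrinking x to l x multiplies the exponential factor by exp(c (1 - l) x) >= 1 + c (1 - l) x; the
    excess over 1 is the quantitative gain. *)
Lemma ricker_sublinear c x l : 0 <= l -> 0 <= x ->
  l * x * expR (- (c * x)) * (c * (1 - l) * x) <= ricker c (l * x) - l * ricker c x.
Proof.
move=> l0 x0; rewrite /ricker.
rewrite (_ : - (c * (l * x)) = - (c * x) + c * (1 - l) * x); last by ring.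
rewrite expRD; have := expR_ge1Dx (c * (1 - l) * x) => h.
rewrite -subr_ge0 [X in 0 <= X](_ : _ = l * x * expR (- (c * x)) *
  (expR (c * (1 - l) * x) - (1 + c * (1 - l) * x))); last by ring.
by rewrite mulr_ge0 ?subr_ge0// mulr_ge0 ?expR_ge0// mulr_ge0.
Qed.

Lemma ricker_lipschitz c x y : 0 <= c -> 0 <= x -> 0 <= y ->
  `|ricker c x - ricker c y| <= `|x - y|.
Proof.
move=> c0; wlog yx : x y / y <= x.
  move=> H x0 y0; have [yx|/ltW xy] := leP y x; first exact: H.
  by rewrite distrC (distrC x); apply: H.
move=> x0 y0; rewrite (ger0_norm (_ : 0 <= x - y)) ?subr_ge0//.
have bnd s : 0 <= s -> 0 <= 1 - (1 - c * s) * expR (- (c * s)) /\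
    0 <= 1 + (1 - c * s) * expR (- (c * s)).
  move=> s0; have cs : 0 <= c * s by exact: mulr_ge0.
  have p := expR_gt0 (- (c * s)).
  have e1 : expR (- (c * s)) <= 1 by rewrite -expR0 ler_expR oppr_le0.
  have : (c * s) * expR (- (c * s)) <= 1.
    rewrite expRN ler_pdivrMr ?expR_gt0// mul1r.
    by apply: le_trans (expR_ge1Dx _); rewrite lerDr.
  have : 0 <= (c * s) * expR (- (c * s)) by rewrite mulr_ge0// ltW.
  rewrite mulrBl mul1r; lra.
have d1 s := is_derive_ricker c s.
rewrite ler_norml; apply/andP; split.
  suff : y + ricker c y <= x + ricker c x by lra.
  apply: (@nondecreasing_of_derive_cc _ (fun s => s + ricker c s)
    (fun s => 1 + (1 - c * s) * expR (- (c * s)))) => // s /andP[ys _].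
  by have [] := bnd s ltac:(lra).
suff : y - ricker c y <= x - ricker c x by lra.
apply: (@nondecreasing_of_derive_cc _ (fun s => s - ricker c s)
  (fun s => 1 - (1 - c * s) * expR (- (c * s)))) => // s /andP[ys _].
by have [] := bnd s ltac:(lra).
Qed.

(** Translating a solution also translates the rate [c]. The derivative in c is of size at most x^2,
    so the estimate is uniform only on bounded solutions. *)
Lemma ricker_rate_lipschitz c c' x : 0 <= c -> 0 <= c' -> 0 <= x ->
  `|ricker c x - ricker c' x| <= `|c - c'| * (x * x).
Proof.
wlog cc' : c c' / c <= c'.
  move=> H c0 c'0 x0; have [?|/ltW ?] := leP c c'; first exact: H.
  by rewrite distrC (distrC c); apply: H.
move=> c0 c'0 x0; rewrite /ricker -mulrBr normrM (ger0_norm x0) mulrCA.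
rewrite ler_wpM2l//.
have cx : c * x <= c' * x by rewrite ler_wpM2r.
rewrite ger0_norm; last by rewrite subr_ge0 ler_expR lerN2.
rewrite (distrC c) ger0_norm ?subr_ge0//.
rewrite (_ : - (c' * x) = - (c * x) + - ((c' - c) * x)); last by ring.
rewrite expRD -[X in X - _]mulr1 -mulrBr.
have h := expR_ge1Dx (- ((c' - c) * x)).
have e1 : expR (- (c * x)) <= 1 by rewrite -expR0 ler_expR oppr_le0 mulr_ge0.
have e2 : 0 <= 1 - expR (- ((c' - c) * x)).
  by rewrite subr_ge0 -expR0 ler_expR oppr_le0 mulr_ge0// subr_ge0.
apply: le_trans (ler_piMl e2 e1) _; lra.
Qed.
End ricker.

(** * Linear differential inequalities *)

Section integrating_factor.
Context {R : realType}.

(** (w exp N)' >= q exp N >= q exp(N s), the last step because N is nondecreasing. With q = 0 this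
    is monotonicity of w exp N; q > 0 serves on the recurrent windows. *)
Lemma integrating_factor (w dw N nu : R -> R) (q s t : R) : s <= t -> 0 <= q ->
  (forall x, s <= x <= t -> is_derive x 1 w (dw x)) ->
  (forall x : R, is_derive x 1 N (nu x)) ->
  (forall x, s <= x <= t -> 0 <= nu x) ->
  (forall x, s <= x <= t -> q <= dw x + nu x * w x) ->
  (w s + q * (t - s)) * expR (N s) <= w t * expR (N t).
Proof.
move=> st q0 dwE dN nu0 qle.
suff : w s * expR (N s) - (q * expR (N s)) * s <=
       w t * expR (N t) - (q * expR (N s)) * t by lra.
apply: (@nondecreasing_of_derive_cc _
  (fun x => w x * expR (N x) - (q * expR (N s)) * x)
  (fun x => (dw x + nu x * w x) * expR (N x) - q * expR (N s))) => // x xst.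
- apply: is_derive_sub; last exact: is_derive_linear.
  have de : is_derive x 1 (fun y => expR (N y)) (expR (N x) * nu x).
    exact: is_derive_comp.
  by apply: is_derive_eq (is_derive_mul w _ _ _ _ (dwE x xst) de) _; ring.
- have Nsx : N s <= N x.
    have /andP[sx xt] := xst.
    apply: (@nondecreasing_of_derive_cc _ N nu) => // y /andP[sy yx].
    by apply: nu0; rewrite sy (le_trans yx).
  rewrite subr_ge0; apply: ler_pM; rewrite ?expR_ge0 ?ler_expR//.
  exact: qle.
Qed.
End integrating_factor.

(** * Comparison of approximate solutions in the exponential ordering *)

Section comparison.
Context {R : realType} {m : nat}.
Variables (r : 'I_m -> R) (d : 'I_m -> R -> R) (a : 'I_m -> 'I_m -> R -> R).
Variables (beta c : 'I_m -> R -> R).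

Lemma nicholson_fieldE (y : 'I_m -> R -> R) i t :
  nicholson_field r d a beta c y i t = - d i t * y i t +
    \sum_(j < m) a i j t * y j t + beta i t * ricker (c i t) (y i (t - r i)).
Proof. by rewrite /nicholson_field /ricker mulrA. Qed.

(** The equation is required only [rb] after the bounds set in, so that every retarded value
    entering it already lies in [M, K]. The derivative is a separate datum because for a translate
    it is the field at translated coefficients. *)
Definition approximate_solution (rb eps M K t0 : R) (y dy : 'I_m -> R -> R) :=
  (forall i t, t0 <= t -> M <= y i t <= K) /\
  forall i (t : R), t0 + rb <= t -> is_derive t 1 (y i) (dy i t) /\
    `|dy i t - nicholson_field r d a beta c y i t| <= eps.

Definition weighted_rate (y dy : 'I_m -> R -> R) i t :=
  dy i t + (d i t + (r i)^-1) * y i t.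

(* From time [tau] on, [y] exceeds [lam * z] for the exponential ordering with
   weights [d i + (r i)^-1]. *)
Definition exp_dominates (y dy z dz : 'I_m -> R -> R) (lam tau : R) :=
  forall i t, tau <= t -> 0 <= y i t - lam * z i t /\
    0 <= weighted_rate y dy i t - lam * weighted_rate z dz i t.

(** [D i] is a primitive of [d i], [eta] is the slack in the delay condition, and every interval of
    length [L] contains a window of length [del] on which all [beta i] are at least [q]. *)
Variables (D : 'I_m -> R -> R) (rb Dm Am Bm Cm c0 eta q del L : R).
Hypotheses (r_gt0 : forall i, 0 < r i) (r_le : forall i, r i <= rb)
  (rV_le : forall i, (r i)^-1 <= rb)
  (d_bnd : forall i t, 0 <= d i t <= Dm) (a_bnd : forall i j t, 0 <= a i j t <= Am)
  (beta_bnd : forall i t, 0 <= beta i t <= Bm)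
  (c_bnd : forall i t, c0 <= c i t <= Cm) (c0_gt0 : 0 < c0) (rb_gt0 : 0 < rb)
  (dD : forall i t, is_derive (t : R) 1 (D i) (d i t))
  (Am_ge0 : 0 <= Am) (Bm_ge0 : 0 <= Bm) (eta_gt0 : 0 < eta)
  (delay_bnd : forall i t,
     beta i t * expR (D i t - D i (t - r i)) * expR (-1) <= (r i)^-1 - eta)
  (q_gt0 : 0 < q) (del_gt0 : 0 < del)
  (beta_recurrent : forall x, exists s, [/\ x <= s, s + del <= x + L &
     forall i u, s <= u <= s + del -> q <= beta i u]).

Let N i t := D i t + (r i)^-1 * t.

Let dN i (t : R) : is_derive t 1 (N i) (d i t + (r i)^-1).
Proof. by apply: is_derive_add; exact: is_derive_linear. Qed.

Let nu_ge0 i t : 0 <= d i t + (r i)^-1.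
Proof. by apply: addr_ge0; [have /andP[] := d_bnd i t|rewrite invr_ge0 ltW]. Qed.

Let N_lip i s t : s <= t -> N i t - N i s <= (Dm + rb) * (t - s).
Proof.
move=> st; suff : (Dm + rb) * s - N i s <= (Dm + rb) * t - N i t by lra.
apply: (@nondecreasing_of_derive_cc _ (fun x => (Dm + rb) * x - N i x)
  (fun x => Dm + rb - (d i x + (r i)^-1))) => // x _.
  by apply: is_derive_sub (dN i x); exact: is_derive_linear.
by rewrite subr_ge0 lerD//; have /andP[] := d_bnd i x.
Qed.

(** The weight cancels the loss term -d_i y_i: for a nonnegative state and up to the defect, only
    nonnegative terms remain. *)
Lemma weighted_rateE y dy i t : weighted_rate y dy i t =
  (dy i t - nicholson_field r d a beta c y i t) + (r i)^-1 * y i t +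
  \sum_(j < m) a i j t * y j t + beta i t * ricker (c i t) (y i (t - r i)).
Proof. by rewrite nicholson_fieldE /weighted_rate; ring. Qed.

Section pair.
Variables (eps M K : R) (M_gt0 : 0 < M) (eps_ge0 : 0 <= eps).

Lemma weighted_rate_bounds t0 y dy i t :
  approximate_solution rb eps M K t0 y dy -> t0 + rb <= t ->
  (r i)^-1 * M - eps <= weighted_rate y dy i t <=
    eps + rb * K + \sum_(j < m) Am * K + Bm * K.
Proof.
move=> [yMK ydy] tt; rewrite weighted_rateE.
have rb0 := rb_gt0; have M0 := M_gt0; have c00 := c0_gt0; have e0 := eps_ge0.
have tr : t0 <= t - r i by have := r_le i; lra.
have ti : t0 <= t by lra.
have /andP[yM yK] := yMK i t ti; have /andP[ydM ydK] := yMK i _ tr.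
have [_] := ydy i t tt; rewrite ler_norml => /andP[e1 e2].
have K0 : 0 <= K by lra.
have /andP[b0 b1] := beta_bnd i t; have /andP[cc0 cc1] := c_bnd i t.
have r1 : 0 <= (r i)^-1 by rewrite invr_ge0 ltW.
have A1 : (r i)^-1 * M <= (r i)^-1 * y i t by exact: ler_wpM2l.
have A2 : (r i)^-1 * y i t <= rb * K.
  by apply: ler_pM => //; lra.
have B1 : 0 <= \sum_(j < m) a i j t * y j t.
  apply: sumr_ge0 => j _; have /andP[? _] := a_bnd i j t.
  by have /andP[? _] := yMK j t ti; apply: mulr_ge0 => //; lra.
have B2 : \sum_(j < m) a i j t * y j t <= \sum_(j < m) Am * K.
  apply: ler_sum => j _; have /andP[? ?] := a_bnd i j t.
  by have /andP[? ?] := yMK j t ti; apply: ler_pM => //; lra.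
have R1 : 0 <= ricker (c i t) (y i (t - r i)) by apply: ricker_ge0; lra.
have R2 : ricker (c i t) (y i (t - r i)) <= y i (t - r i).
  by apply: ricker_le_id; lra.
have C1 : 0 <= beta i t * ricker (c i t) (y i (t - r i)) by exact: mulr_ge0.
have C2 : beta i t * ricker (c i t) (y i (t - r i)) <= Bm * K.
  by apply: ler_pM => //; lra.
by apply/andP; split; lra.
Qed.

Variables (t0 : R) (y dy z dz : 'I_m -> R -> R).
Hypotheses (soly : approximate_solution rb eps M K t0 y dy)
  (solz : approximate_solution rb eps M K t0 z dz).

Lemma weighted_gap_nondecreasing lam tau q' i s t : t0 + rb <= tau ->
  tau <= s -> s <= t -> 0 <= q' ->
  (forall x, s <= x <= t ->
    q' <= weighted_rate y dy i x - lam * weighted_rate z dz i x) ->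
  (y i s - lam * z i s + q' * (t - s)) * expR (N i s) <=
  (y i t - lam * z i t) * expR (N i t).
Proof.
move=> ttau taus st q'0 qle.
apply: (@integrating_factor _ (fun x => y i x - lam * z i x)
  (fun x => dy i x - lam * dz i x) (N i) (fun x => d i x + (r i)^-1)) => //.
- move=> x /andP[sx xt].
  have [dyx _] := soly.2 i x ltac:(lra); have [dzx _] := solz.2 i x ltac:(lra).
  by apply: is_derive_sub; exact: is_derive_scale.
- by move=> x /qle; rewrite /weighted_rate; lra.
Qed.

Variables (lam0 theta : R) (lam0_gt0 : 0 < lam0) (theta_gt0 : 0 < theta)
  (theta_le1 : theta <= 1).

(** The gain of [ricker_sublinear] bounded below over states in [M, K] and factors in
    [lam0, 1 - theta]. *)
Let g0 := lam0 * M * expR (- (Cm * K)) * (c0 * theta * M).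

Lemma sublinear_gain lam i t : lam0 <= lam <= 1 - theta -> t0 + rb <= t ->
  g0 <= ricker (c i t) (lam * z i (t - r i)) - lam * ricker (c i t) (z i (t - r i)).
Proof.
move=> /andP[l0 l1] tt.
have l00 := lam0_gt0; have th0 := theta_gt0; have th1 := theta_le1.
have M0 := M_gt0; have c00 := c0_gt0.
have tr : t0 <= t - r i by have := r_le i; lra.
have /andP[zM zK] := solz.1 i _ tr; have /andP[cc0 cc1] := c_bnd i t.
apply: le_trans (ricker_sublinear _ _ _ _ _); [|lra|lra].
have e1 : expR (- (Cm * K)) <= expR (- (c i t * z i (t - r i))).
  by rewrite ler_expR lerN2; apply: ler_pM; lra.
have := expR_ge0 (- (Cm * K)) => e0.
have h1 : lam0 * M <= lam * z i (t - r i) by apply: ler_pM; lra.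
have h2 : lam0 * M * expR (- (Cm * K)) <=
    lam * z i (t - r i) * expR (- (c i t * z i (t - r i))).
  by apply: ler_pM => //; rewrite mulr_ge0//; lra.
have h3 : c0 * theta * M <= c i t * (1 - lam) * z i (t - r i).
  apply: ler_pM; [by rewrite mulr_ge0; lra|lra| |lra].
  by apply: ler_pM; lra.
by apply: ler_pM => //; rewrite ?mulr_ge0//; lra.
Qed.

(** Domination makes all terms nonnegative except the delayed one, which loses at most beta_i
    exp(-2) w(t - r_i). The integrating factor turns this into a multiple of w(t), the delay
    condition bounds it by (1/r_i - eta) w(t), and the term w/r_i of the weighted rate absorbs it.
    The loss 2 eps comes from the two defects. *)
Lemma defect_lower_bound lam tau i t : lam0 <= lam <= 1 - theta ->
  exp_dominates y dy z dz lam tau -> t0 + rb <= tau -> tau + rb <= t ->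
  eta * (y i t - lam * z i t) + beta i t * g0 - 2 * eps <=
  weighted_rate y dy i t - lam * weighted_rate z dz i t.
Proof.
move=> /[dup] lrange /andP[l0 l1] dom ttau taut.
have tr : tau <= t - r i by have := r_le i; lra.
have rb0 := rb_gt0; have e0 := eps_ge0; have l00 := lam0_gt0.
have th0 := theta_gt0; have et0 := eta_gt0.
have tt : t0 + rb <= t by lra.
set w := y i t - lam * z i t; set wd := y i (t - r i) - lam * z i (t - r i).
have [w0 _] := dom i t ltac:(lra); rewrite -/w in w0.
have [wd0 _] := dom i _ tr; rewrite -/wd in wd0.
have gain := sublinear_gain lam i t lrange tt.
have slope := @ricker_slope R (c i t) (lam * z i (t - r i)) (y i (t - r i))
  ltac:(rewrite -subr_ge0; exact: wd0).
have /andP[b0 b1] := beta_bnd i t.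
(* w exp N is nondecreasing on [t - r_i, t], where N grows by the integral of d_i plus exactly 1;
   this turns exp(-2) into exp(-1). *)
have wdw : expR (-2) * wd <= expR (D i t - D i (t - r i)) * expR (-1) * w.
  have := weighted_gap_nondecreasing lam tau 0 i (t - r i) t ttau tr
    ltac:(have := r_gt0 i; lra) (lexx 0) _.
  rewrite mul0r addr0 -/w -/wd => /(_ _)/wrap[].
    by move=> x /andP[? ?]; have [] := dom i x ltac:(lra).
  move=> h; have -> : expR (D i t - D i (t - r i)) * expR (-1) =
      expR (N i t) * (expR (- N i (t - r i)) * expR (-2)).
    rewrite -!expRD; congr expR; rewrite /N mulrBr mulVf ?gt_eqF//; ring.
  have -> : expR (-2) * wd =
      wd * expR (N i (t - r i)) * (expR (- N i (t - r i)) * expR (-2)).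
    rewrite mulrA -(mulrA wd) -expRD subrr expR0 mulr1; ring.
  have p : 0 <= expR (- N i (t - r i)) * expR (-2) by rewrite mulr_ge0 ?expR_ge0.
  by have := ler_wpM2r p h; lra.
have [_] := soly.2 i t tt; rewrite ler_norml => /andP[ey1 ey2].
have [_ ez] := solz.2 i t tt.
have ez2 : lam * (dz i t - nicholson_field r d a beta c z i t) <= eps.
  apply: le_trans (ler_norm _) _; rewrite normrM -[leRHS]mul1r.
  by apply: ler_pM => //; rewrite ger0_norm; lra.
rewrite !weighted_rateE.
have S0 : 0 <= \sum_(j < m) a i j t * y j t - lam * \sum_(j < m) a i j t * z j t.
  rewrite mulr_sumr -sumrB; apply: sumr_ge0 => j _.
  have [wj _] := dom j t ltac:(lra).
  rewrite (_ : _ - _ = a i j t * (y j t - lam * z j t)); last by ring.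
  by rewrite mulr_ge0//; have /andP[] := a_bnd i j t.
(* The difference passes through the value at lam z: from y to lam z the slope bound applies, from
   there the sublinear gain. *)
have B1 : beta i t * (g0 - expR (-2) * wd) <= beta i t *
    (ricker (c i t) (y i (t - r i)) - lam * ricker (c i t) (z i (t - r i))).
  by apply: ler_wpM2l => //; rewrite /wd; lra.
have B2 : beta i t * (expR (-2) * wd) <= ((r i)^-1 - eta) * w.
  apply: le_trans (ler_wpM2l b0 wdw) _; rewrite !mulrA.
  exact: ler_wpM2r.
rewrite /w in B2 *; lra.
Qed.

(** A window within the last [L] units of time raises y - lam z by a fixed amount; afterwards it
    decays at most at rate Dm + rb. The bound on eps makes the defects cost at most half of the gain
    q g0. *)
Lemma gap_lower_bound lam tau i t : lam0 <= lam <= 1 - theta ->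
  exp_dominates y dy z dz lam tau -> t0 + rb <= tau -> 4 * eps <= q * g0 ->
  tau + rb + L <= t ->
  q * g0 / 2 * del * expR (- ((Dm + rb) * L)) <= y i t - lam * z i t.
Proof.
move=> lrange dom ttau epsq taut.
have rb0 := rb_gt0; have e0 := eps_ge0; have q0 := q_gt0; have del0 := del_gt0.
have [s [s1 s2 sq]] := beta_recurrent (t - L).
have qg : 0 <= q * g0 / 2 by lra.
have g00 : 0 <= g0 by have := qg; rewrite pmulr_lge0// pmulr_rge0.
have ds : t0 + rb <= s by lra.
have h1 := weighted_gap_nondecreasing lam tau (q * g0 / 2) i s (s + del) ttau
  ltac:(lra) ltac:(lra) qg.
have {}h1 : (y i s - lam * z i s + q * g0 / 2 * (s + del - s)) * expR (N i s) <=
  (y i (s + del) - lam * z i (s + del)) * expR (N i (s + del)).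
  apply: h1 => x xs; have := defect_lower_bound lam tau i x lrange dom ttau.
  move=> /(_ ltac:(lra)).
  have [w0 _] := dom i x ltac:(lra).
  have : 0 <= eta * (y i x - lam * z i x) by rewrite mulr_ge0// ltW.
  have : q * g0 <= beta i x * g0 by rewrite ler_wpM2r// sq.
  lra.
have h2 := weighted_gap_nondecreasing lam tau 0 i (s + del) t ttau
  ltac:(lra) ltac:(lra) (lexx 0).
have {}h2 : (y i (s + del) - lam * z i (s + del) + 0 * (t - (s + del))) *
    expR (N i (s + del)) <= (y i t - lam * z i t) * expR (N i t).
  by apply: h2 => x xs; have [] := dom i x ltac:(lra).
have [ws _] := dom i s ltac:(lra).
have en0 := expR_ge0 (N i s).
have ee : 0 <= (y i s - lam * z i s) * expR (N i s) by exact: mulr_ge0.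
have h3 : q * g0 / 2 * del * expR (N i s) <= (y i t - lam * z i t) * expR (N i t).
  by lra.
have h4 : q * g0 / 2 * del * expR (N i s - N i t) <= y i t - lam * z i t.
  by rewrite expRD mulrA expRN ler_pdivrMr ?expR_gt0.
apply: le_trans h4; apply: ler_wpM2l.
  by apply: mulr_ge0 => //; exact: ltW.
rewrite ler_expR; have := N_lip i s t ltac:(lra).
have : (Dm + rb) * (t - s) <= (Dm + rb) * L.
  apply: ler_wpM2l; last lra.
  by have /andP[] := d_bnd i 0; lra.
lra.
Qed.

Let gap := q * g0 / 2 * del * expR (- ((Dm + rb) * L)).

(** The increment is paid for by the gap in the values and by eta times the gap in the rates, half
    of the latter covering the defects. The gain at time t is merely discarded as nonnegative, since
    beta_i t may be tiny. [sigma] depends on neither lam nor tau. *)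
Lemma exp_dominates_step lam tau sigma : lam0 <= lam <= 1 - theta ->
  4 * eps <= q * g0 -> 4 * eps <= eta * gap -> 0 <= sigma -> sigma * K <= gap ->
  sigma * (eps + rb * K + \sum_(j < m) Am * K + Bm * K) <= eta * gap / 2 ->
  t0 + rb <= tau -> exp_dominates y dy z dz lam tau ->
  exp_dominates y dy z dz (lam + sigma) (tau + (rb + L)).
Proof.
move=> lrange eps1 eps2 sig0 sigK sigP ttau dom i t taut.
have rb0 := rb_gt0; have et0 := eta_gt0; have q0 := q_gt0; have e0 := eps_ge0.
have M0 := M_gt0; have del0 := del_gt0.
have [s [s1 s2 _]] := beta_recurrent 0.
have h1 := gap_lower_bound lam tau i t lrange dom ttau eps1 ltac:(lra).
have h2 := defect_lower_bound lam tau i t lrange dom ttau ltac:(lra).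
have /andP[_ h3] := weighted_rate_bounds t0 z dz i t solz ltac:(lra).
have /andP[zM zK] := solz.1 i t ltac:(lra).
have h4 : sigma * z i t <= sigma * K by rewrite ler_wpM2l.
have h5 : sigma * weighted_rate z dz i t <=
    sigma * (eps + rb * K + \sum_(j < m) Am * K + Bm * K) by rewrite ler_wpM2l.
have h6 : eta * gap <= eta * (y i t - lam * z i t) by rewrite ler_pM2l.
have g00 : 0 <= g0.
  by rewrite -(pmulr_rge0 _ q0); apply: le_trans eps1; rewrite mulr_ge0.
have h7 : 0 <= beta i t * g0 by rewrite mulr_ge0//; have /andP[] := beta_bnd i t.
rewrite -/gap in h1; split; lra.
Qed.

Lemma exp_dominates_initial : lam0 * K <= M ->
  lam0 * (eps + rb * K + \sum_(j < m) Am * K + Bm * K) + eps <= M / rb ->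
  exp_dominates y dy z dz lam0 (t0 + rb).
Proof.
move=> lK lP i t tt; have rb0 := rb_gt0; have l0 := lam0_gt0.
have /andP[yM yK] := soly.1 i t ltac:(lra).
have /andP[zM zK] := solz.1 i t ltac:(lra).
have /andP[py _] := weighted_rate_bounds t0 y dy i t soly tt.
have /andP[_ pz] := weighted_rate_bounds t0 z dz i t solz tt.
have h1 : lam0 * z i t <= lam0 * K by rewrite ler_pM2l.
have h2 : lam0 * weighted_rate z dz i t <=
  lam0 * (eps + rb * K + \sum_(j < m) Am * K + Bm * K) by rewrite ler_pM2l.
have h3 : M / rb <= (r i)^-1 * M.
  rewrite mulrC; apply: ler_wpM2r; first exact: ltW.
  by rewrite lef_pV2 ?posrE// r_gt0.
split; lra.
Qed.
End pair.

Lemma exists_pos_le4 (e1 e2 e3 e4 : R) : 0 < e1 -> 0 < e2 -> 0 < e3 -> 0 < e4 ->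
  exists e, [/\ 0 < e, e <= e1, e <= e2, e <= e3 & e <= e4].
Proof.
move=> *; exists (Num.min (Num.min e1 e2) (Num.min e3 e4)).
by rewrite !lt_min !ge_min !lexx ?orbT; split => //; apply/andP; split; apply/andP.
Qed.

(** The uniformity of eps and T in the starting time and in the two solutions is what later allows a
    solution to be compared with all its translates. *)
Lemma comparison (M K theta : R) : 0 < M -> 0 < K -> 0 < theta -> theta <= 1 ->
  exists eps T : R, [/\ 0 < eps, 0 <= T & forall t0 y dy z dz,
    approximate_solution rb eps M K t0 y dy ->
    approximate_solution rb eps M K t0 z dz ->
    forall i t, t0 + T <= t -> (1 - theta) * z i t <= y i t].
Proof.
move=> M0 K0 th0 th1.
have rb0 := rb_gt0; have et0 := eta_gt0; have q0 := q_gt0; have del0 := del_gt0.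
have c00 := c0_gt0.
have L0 : 0 <= L by have [s [s1 s2 _]] := beta_recurrent 0; lra.
have S0 : 0 <= \sum_(j < m) Am * K.
  by apply: sumr_ge0 => j _; apply: mulr_ge0; [exact: Am_ge0|lra].
pose Pb := 1 + rb * K + \sum_(j < m) Am * K + Bm * K.
have Pb0 : 0 < Pb.
  have : 0 <= Bm * K by apply: mulr_ge0; [exact: Bm_ge0|lra].
  have : 0 < rb * K by exact: mulr_gt0.
  by rewrite /Pb; lra.
have den0 : 0 < K + 2 * rb * Pb by rewrite addr_gt0// !mulr_gt0.
(* Small enough for both halves of the initial order: lam0 K <= M for the values and lam0 Pb <= M /
   (2 rb) for the rates, the other half of M / rb being reserved for eps. *)
pose lam0 := M / (K + 2 * rb * Pb).
have lam00 : 0 < lam0 by exact: divr_gt0.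
have lamK : lam0 * K <= M.
  by rewrite /lam0 mulrAC ler_pdivrMr// ler_pM2l// lerDl ltW// !mulr_gt0.
have lamP : lam0 * Pb <= M / rb / 2.
  rewrite ler_pdivlMr// ler_pdivlMr//.
  rewrite (_ : lam0 * Pb * 2 * rb = M * (2 * rb * Pb) / (K + 2 * rb * Pb)).
    by rewrite ler_pdivrMr// ler_pM2l// lerDr ltW.
  by rewrite /lam0; ring.
clearbody lam0; pose g := lam0 * M * expR (- (Cm * K)) * (c0 * theta * M).
have g0 : 0 < g by rewrite /g !mulr_gt0 ?expR_gt0.
pose gap := q * g / 2 * del * expR (- ((Dm + rb) * L)).
have gap0 : 0 < gap by rewrite /gap !mulr_gt0 ?expR_gt0 ?invr_gt0.
have [eps [eps0 eps1 eps2 eps3 eps4]] := @exists_pos_le4 1 (M / rb / 2)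
  (q * g / 4) (eta * gap / 4) ltr01 ltac:(by rewrite !divr_gt0)
  ltac:(by rewrite divr_gt0// mulr_gt0) ltac:(by rewrite divr_gt0// mulr_gt0).
have [sig [sig0 sig1 sig2 _ _]] := @exists_pos_le4 (gap / K) (eta * gap / 2 / Pb)
  1 1 ltac:(by rewrite divr_gt0)
  ltac:(by rewrite !divr_gt0// mulr_gt0) ltr01 ltr01.
rewrite ler_pdivlMr// in sig1; rewrite ler_pdivlMr// in sig2.
(* n sig >= 1, so n increments reach 1 - theta from any positive starting factor. *)
pose n := (Num.truncn sig^-1).+1.
exists eps, (rb + n%:R * (rb + L)); split => //.
  by rewrite addr_ge0 ?mulr_ge0 ?addr_ge0// ltW.
move=> t0 y dy z dz soly solz i t tt.
have Pbe : eps + rb * K + \sum_(j < m) Am * K + Bm * K <= Pb by rewrite /Pb; lra.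
(* Beyond 1 - theta the gain is no longer controlled, so lam is then frozen; the disjunction records
   which case holds. *)
have rec k : exists2 lam, lam0 <= lam &
    exp_dominates y dy z dz lam (t0 + rb + k%:R * (rb + L)) /\
    (1 - theta < lam \/ lam0 + k%:R * sig <= lam).
  elim: k => [|k [lam lam1 [dom H]]].
    exists lam0 => //; rewrite mul0r addr0; split; last by right; rewrite mul0r addr0.
    apply: (@exp_dominates_initial eps M K M0 (ltW eps0) t0) => //.
    have : lam0 * (eps + rb * K + \sum_(j < m) Am * K + Bm * K) <= lam0 * Pb.
      by rewrite ler_pM2l.
    by lra.
  have kS : k.+1%:R = k%:R + 1 :> R by rewrite -natr1.
  have k0 : 0 <= k%:R * (rb + L) by rewrite mulr_ge0// addr_ge0// ltW.
  have [lth|lth] := ltP (1 - theta) lam.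
    exists lam => //; split; last by left.
    by move=> j s js; apply: dom; rewrite kS in js; lra.
  case: H => [|H]; first by rewrite ltNge lth.
  exists (lam + sig); first lra.
  split; last by right; rewrite kS; lra.
  rewrite kS mulrDl mul1r addrA.
  apply: (@exp_dominates_step eps M K M0 (ltW eps0) t0 y dy z dz soly solz lam0
    theta lam00 th0 th1 lam) => //.
  - by rewrite lam1 lth.
  - by rewrite -/g; lra.
  - by rewrite -/g -/gap; lra.
  - exact: ltW.
  - apply: le_trans sig2; rewrite ler_pM2l//.
  - lra.
have [lam lam1 [dom H]] := rec n.
have nL : 0 <= n%:R * (rb + L) by rewrite mulr_ge0// addr_ge0// ltW.
have /andP[zM _] := solz.1 i t ltac:(lra).
have [ylz _] := dom i t ltac:(lra).
have lth : 1 - theta <= lam.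
  case: H => [/ltW//|]; have : 1 <= n%:R * sig.
    by rewrite -ler_pdivrMr// div1r ltW// /n truncnS_gt.
  lra.
have : (1 - theta) * z i t <= lam * z i t by rewrite ler_wpM2r//; lra.
lra.
Qed.
End comparison.

(** * Finite families and recurrence of positivity *)

Section finite_families.
Context {R : realType}.

Lemma finite_upper_bound {I : finType} (f : I -> R) :
  exists2 B : R, 0 < B & forall i, f i <= B.
Proof.
exists (1 + \sum_i `|f i|) => [|i]; first by rewrite ltr_pwDl// sumr_ge0.
apply: le_trans (ler_norm _) _.
by rewrite (bigD1 i)//= addrCA lerDl addr_ge0// sumr_ge0.
Qed.

Lemma finite_lower_bound {I : finType} (f : I -> R) : (forall i, 0 < f i) ->
  exists2 e : R, 0 < e & forall i, e <= f i.
Proof.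
move=> f0; have [B B0 fB] := finite_upper_bound (fun i => (f i)^-1).
exists B^-1 => [|i]; first by rewrite invr_gt0.
by rewrite -[f i]invrK lef_pV2 ?posrE ?invr_gt0.
Qed.

Lemma continuous_sum {I : finType} (f : I -> R -> R) :
  (forall i, continuous (f i)) -> continuous (fun t => \sum_i f i t).
Proof.
move=> cf t; apply: cvg_big => [|i _]; last exact: cf.
exact: add_continuous.
Qed.
End finite_families.

Section almost_periodic_families.
Context {R : realType}.

(** Functions controlled by the almost periods of a finite family inherit a relatively dense set of
    them; this is applied to the column surplus and to the limit solution. *)
Lemma almost_periodic_of_common_periods {I : finType} (f : I -> R -> R) (p : R -> R) :
  (forall i, almost_periodic (f i)) -> continuous p ->
  (forall eps : R, 0 < eps -> exists2 eps' : R, 0 < eps' &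
    forall s, common_period f eps' s -> forall t, `|p (t + s) - p t| < eps) ->
  almost_periodic p.
Proof.
move=> apf cp pf; split=> // eps /pf [eps' e'0 H].
have [l l0 hl] := common_periods_relatively_dense f eps' apf e'0.
exists l => // x; have [s /= fs xs] := hl x.
by exists s => //=; exact: H.
Qed.

Lemma almost_periodic_sub_sum {n : nat} (f : R -> R) (g : 'I_n -> R -> R) :
  almost_periodic f -> (forall j, almost_periodic (g j)) ->
  almost_periodic (fun t => f t - \sum_(j < n) g j t).
Proof.
move=> apf apg.
apply: (@almost_periodic_of_common_periods (option 'I_n)
  (fun o => if o is Some j then g j else f)).
- by case.
- move=> t; apply: cvgB; first exact: apf.1.
  by apply: continuous_sum => j; exact: (apg j).1.
move=> eps e0; exists (eps / (n.+1%:R)); first by rewrite divr_gt0.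
move=> s cs t.
have h j : `|g j (t + s) - g j t| <= eps / n.+1%:R by exact/ltW/(cs (Some j)).
have h0 : `|f (t + s) - f t| < eps / n.+1%:R by exact: (cs None).
rewrite (_ : _ - _ = (f (t + s) - f t) -
  \sum_(j < n) (g j (t + s) - g j t)); last by rewrite sumrB; ring.
apply: le_lt_trans (ler_normB _ _) _.
have -> : eps = eps / n.+1%:R + \sum_(j < n) (eps / n.+1%:R).
  by rewrite sumr_const card_ord -mulrS -[RHS]mulr_natr divfK.
apply: ltr_leD => //; apply: le_trans (ler_norm_sum _ _ _) _.
exact: ler_sum.
Qed.

(** A substitute for a positive infimum: values at least e at time 0 stay above 2e/3 nearby by
    uniform continuity, and above e/3 after a common almost period. *)
Lemma almost_periodic_recurrently_positive {I : finType} (p : I -> R -> R) :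
  (forall i, almost_periodic (p i)) -> (forall i, 0 < p i 0) ->
  exists q del L : R, [/\ 0 < q, 0 < del & forall x, exists s,
    [/\ x <= s, s + del <= x + L & forall i u, s <= u <= s + del -> q <= p i u]].
Proof.
move=> app p0.
have [e e0 pe] := finite_lower_bound (fun i => p i 0) p0.
have e3 : 0 < e / 3 by rewrite divr_gt0.
have [eta Heta] : {eta : I -> R & forall i, 0 < eta i /\
    forall u, `|u| < eta i -> `|p i u - p i 0| < e / 3}.
  apply: (@choice I R (fun i h => 0 < h /\
    forall u, `|u| < h -> `|p i u - p i 0| < e / 3)) => i.
  have [h h0 H] := almost_periodic_uniformly_continuous (p i) (e / 3) (app i) e3.
  by exists h; split=> // u uh; apply: H; rewrite subr0.
have [del del0 Hdel] := finite_lower_bound eta (fun i => (Heta i).1).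
have [l l0 hl] := common_periods_relatively_dense p (e / 3) app e3.
exists (e / 3), (del / 2), (l + del / 2); split; rewrite ?divr_gt0// => x.
have [s /= cs xs] := hl x; exists s; split; [lra|lra|move=> i u us].
have h1 := cs i (u - s); rewrite subrK in h1.
have h2 : `|p i (u - s) - p i 0| < e / 3.
  apply: (Heta i).2; apply: lt_le_trans (Hdel i).
  by rewrite ger0_norm; lra.
have := pe i; move: h1 h2; rewrite !ltr_norml; lra.
Qed.
End almost_periodic_families.

(** * Upper bounds from dissipation on recurrent windows *)

Section recurrent_decay.
Context {R : realType}.

(** Over a time L, growth is at most B L before and after a window, and the window contracts S - B/q
    by rho = exp(-q del). Altogether S (x + L) <= rho S x + B/q + 2 B L. *)
Lemma bounded_of_recurrent_decay (S dS : R -> R) (T0 B q del L : R) :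
  0 < q -> 0 < del -> 0 <= B ->
  (forall t, T0 <= t -> is_derive t 1 S (dS t)) ->
  (forall t, T0 <= t -> dS t <= B) ->
  (forall x, exists s, [/\ x <= s, s + del <= x + L &
     forall u, s <= u <= s + del -> T0 <= u -> dS u <= B - q * S u]) ->
  exists K, forall t, T0 <= t -> S t <= K.
Proof.
move=> q0 del0 B0 dSE dSB dec.
have L0 : 0 < L by have [s [? ? _]] := dec 0; lra.
have grow x t : T0 <= x -> x <= t -> S t <= S x + B * (t - x).
  move=> Tx xt; suff : B * x - S x <= B * t - S t by lra.
  apply: (@nondecreasing_of_derive_cc _ (fun u => B * u - S u)
    (fun u => B - dS u)) => // u /andP[xu ut].
    apply: is_derive_sub; first exact: is_derive_linear.
    by apply: dSE; lra.
  by rewrite subr_ge0 dSB//; lra.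
pose rho := expR (- (q * del)).
have rho1 : rho < 1 by rewrite /rho -expR0 ltr_expR oppr_lt0 mulr_gt0.
have rho0 : 0 < rho by exact: expR_gt0.
(* The second summand is the fixed point of K = rho K + B/q + 2 B L; adding |S T0| keeps the level
   invariant and includes the start. *)
pose K1 := `|S T0| + (B / q + 2 * B * L) / (1 - rho).
have Bq : 0 <= B / q by rewrite divr_ge0// ltW.
have BL : 0 <= B * L by rewrite mulr_ge0// ltW.
have K1S : S T0 <= K1.
  apply: le_trans (ler_norm _) _; rewrite lerDl divr_ge0//; first lra.
  by rewrite subr_ge0 ltW.
have K1rho : rho * K1 + (B / q + 2 * B * L) <= K1.
  have h : (1 - rho) * K1 = (1 - rho) * `|S T0| + (B / q + 2 * B * L).
    by rewrite /K1 mulrDr [X in _ + X = _]mulrC divfK//; lra.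
  have : 0 <= (1 - rho) * `|S T0| by rewrite mulr_ge0// subr_ge0 ltW.
  lra.
have step x : T0 <= x -> S x <= K1 -> S (x + L) <= K1.
  move=> Tx SK; have [s [xs sL dSq]] := dec x.
  have h1 := grow x s Tx xs.
  have h2 := grow (s + del) (x + L) ltac:(lra) sL.
  have h3 : S (s + del) - B / q <= rho * (S s - B / q).
    have : (B / q - S s + 0 * (s + del - s)) * expR (q * s) <=
        (B / q - S (s + del)) * expR (q * (s + del)).
      apply: (@integrating_factor _ (fun u => B / q - S u) (fun u => 0 - dS u)
        (fun u => q * u) (fun=> q)); [lra|exact: lexx| | | |].
      - move=> u us; have du : is_derive u 1 S (dS u) by apply: dSE; lra.
        exact: is_derive_sub.
      - by move=> u; exact: is_derive_linear.
      - by move=> *; exact: ltW.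
      - move=> u us; rewrite sub0r mulrBr mulrCA divff ?gt_eqF// mulr1.
        by have := dSq u us ltac:(lra); lra.
    rewrite mul0r addr0 mulrDr expRD mulrA => h.
    rewrite /rho expRN ler_pdivlMl ?expR_gt0//.
    have p := expR_gt0 (q * s); rewrite -(ler_pM2r p).
    by move: h; lra.
  have h4 : rho * S s <= rho * (S x + B * L).
    rewrite ler_pM2l//; apply: le_trans h1 _; rewrite lerD2l ler_wpM2l//; lra.
  have h5 : B * (x + L - (s + del)) <= B * L by rewrite ler_wpM2l//; lra.
  have h6 : rho * (B * L) <= B * L by rewrite ler_piMl// ltW.
  have h7 : rho * S x <= rho * K1 by rewrite ler_pM2l.
  have h8 : 0 <= rho * (B / q) by rewrite mulr_ge0// ltW.
  lra.
have stepn n : S (T0 + n%:R * L) <= K1 /\ T0 <= T0 + n%:R * L.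
  elim: n => [|n [IH1 IH2]]; first by rewrite mul0r addr0.
  rewrite -natr1 mulrDl mul1r addrA; split; first exact: step.
  by lra.
exists (K1 + B * L) => t Tt.
have tT : 0 <= (t - T0) / L by rewrite divr_ge0 ?subr_ge0// ltW.
have := truncn_itv tT; set n := Num.truncn _.
rewrite ler_pdivlMr// ltr_pdivrMr// -natr1 => /andP[n1 n2].
have [Sn Tn] := stepn n.
have := grow (T0 + n%:R * L) t Tn ltac:(lra).
have : B * (t - (T0 + n%:R * L)) <= B * L by rewrite ler_wpM2l//; lra.
lra.
Qed.
End recurrent_decay.

(** * Integrals over segments as increments of primitives *)

Section segment_integral.
Context {R : realType}.

Lemma Rintegral_primitive (f F : R -> R) (s t : R) : s < t -> continuous f ->
  (forall x : R, is_derive x 1 F (f x)) ->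
  \int[lebesgue_measure]_(x in `[s, t]) f x = F t - F s.
Proof.
move=> st cf dF; rewrite /Rintegral (@continuous_FTC2 _ f F)//.
- exact: continuous_subspaceT.
- split; first by move=> x _; have [] := dF x.
    by apply: cvg_at_right_filter; exact: is_derive_continuous (dF s).
  by apply: cvg_at_left_filter; exact: is_derive_continuous (dF t).
- by move=> x _; rewrite derive1E; have [_] := dF x.
Qed.
End segment_integral.

(** * A positive solution of the Nicholson system *)

Section existence.
Context {R : realType} {m : nat}.

Lemma continuous_ricker (c x : R -> R) : continuous c -> continuous x ->
  continuous (fun t => ricker (c t) (x t)).
Proof.
move=> cc cx t; apply: cvgM; first exact: cx.
apply: (@continuous_comp _ _ _ (fun t => - (c t * x t)) expR).
  by apply: cvgN; apply: cvgM; [exact: cc|exact: cx].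
exact: continuous_expR.
Qed.

Lemma continuous_translate (f : R -> R) s : continuous f ->
  continuous (fun t => f (t + s)).
Proof.
move=> cf t; apply: (@continuous_comp _ _ _ (fun t => t + s) f); last exact: cf.
by apply: cvgD; [exact: cvg_id|exact: cvg_cst].
Qed.

Let pos (x : R) := Num.max x 0.

Let pos_ge0 x : 0 <= pos x. Proof. by rewrite le_max lexx orbT. Qed.

Let pos_lip x y : `|pos x - pos y| <= `|x - y|.
Proof.
rewrite /pos; have [x0|x0] := leP x 0; have [y0|y0] := leP y 0;
  rewrite ?subrr ?normr0 ?normr_ge0 //.
- by rewrite sub0r normrN gtr0_norm// ler0_norm; lra.
- by rewrite subr0 gtr0_norm// ger0_norm; lra.
Qed.

Let continuous_pos (y : R -> R) : continuous y -> continuous (fun t => pos (y t)).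
Proof.
move=> cy t; apply: (@continuous_max R R y (fun=> 0)); first exact: cy.
exact: cvg_cst.
Qed.

(* Replacing [y] by its positive part where the field is not monotone makes the
   field globally Lipschitz; the solution is then seen to stay positive. *)
Lemma nicholson_solution_exists (r : 'I_m -> R) (d : 'I_m -> R -> R)
    (a : 'I_m -> 'I_m -> R -> R) (beta c : 'I_m -> R -> R) (Dm Am Bm : R) :
  (forall i, 0 < r i) ->
  (forall i, continuous (d i)) -> (forall i j, continuous (a i j)) ->
  (forall i, continuous (beta i)) -> (forall i, continuous (c i)) ->
  (forall i t, 0 <= d i t <= Dm) -> (forall i j t, 0 <= a i j t <= Am) ->
  (forall i t, 0 <= beta i t <= Bm) -> (forall i t, 0 <= c i t) ->
  0 <= Dm -> 0 <= Am -> 0 <= Bm ->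
  exists y, nicholson_solution_from r d a beta c (fun _ _ => 1) y.
Proof.
move=> r0 cd ca cb cc db ab bb cge0 D0 A0 B0.
(* The loss -d_i y_i is split as (Dm - d_i) y_i - Dm y_i and only the first part is truncated. Then
   y' >= -Dm y holds before positivity is known, and positivity follows from the growth of y exp(Dm
   t). *)
pose G (y : 'I_m -> R -> R) i t := (Dm - d i t) * pos (y i t) +
  \sum_(j < m) a i j t * pos (y j t) +
  beta i t * ricker (c i t) (pos (y i (t - r i))) - Dm * y i t.
have S0 : 0 <= \sum_(j < m) Am by apply: sumr_ge0.
have [|||y [cy y1 dy]] := @picard_retarded R 'I_m G (fun=> 1)
    (2 * Dm + \sum_(j < m) Am + Bm + 1) (2 * Dm + \sum_(j < m) Am + Bm) ltac:(lra).
- move=> y cy i; rewrite /G => t.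
  apply: cvgB; last by apply: cvgM; [exact: cvg_cst|exact: cy].
  apply: cvgD; first apply: cvgD.
  + apply: cvgM; last exact: continuous_pos.
    by apply: cvgB; [exact: cvg_cst|exact: cd].
  + apply: continuous_sum => j s; apply: cvgM; first exact: ca.
    exact: continuous_pos.
  + apply: cvgM; first exact: cb.
    apply: (@continuous_ricker (c i) (fun s => pos (y i (s - r i)))) => //.
    by apply: continuous_pos; exact: continuous_translate.
- move=> y z C kap C0 kap0 yz i t; set E := C * expR (kap * t).
  have E0 : 0 <= E by rewrite mulr_ge0// expR_ge0.
  have pE j : `|pos (y j t) - pos (z j t)| <= E by apply: le_trans (pos_lip _ _) _.
  have h1 : `|(Dm - d i t) * (pos (y i t) - pos (z i t))| <= Dm * E.
    rewrite normrM; apply: ler_pM => //.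
    by have /andP[? ?] := db i t; rewrite ger0_norm; lra.
  have h2 : `|\sum_(j < m) a i j t * (pos (y j t) - pos (z j t))| <=
      (\sum_(j < m) Am) * E.
    apply: le_trans (ler_norm_sum _ _ _) _; rewrite mulr_suml; apply: ler_sum => j _.
    rewrite normrM; apply: ler_pM => //.
    by have /andP[? ?] := ab i j t; rewrite ger0_norm; lra.
  have h3 : `|beta i t * (ricker (c i t) (pos (y i (t - r i))) -
      ricker (c i t) (pos (z i (t - r i))))| <= Bm * E.
    rewrite normrM; apply: ler_pM => //.
      by have /andP[? ?] := bb i t; rewrite ger0_norm; lra.
    apply: le_trans (ricker_lipschitz _ _ _ _ _ _) _ => //.
    apply: le_trans (pos_lip _ _) _; apply: le_trans (yz _ _) _.
    rewrite ler_wpM2l// ler_expR ler_wpM2l// gerBl.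
    exact: ltW.
  have h4 : `|Dm * (y i t - z i t)| <= Dm * E.
    by rewrite normrM ger0_norm// ler_wpM2l.
  have -> : G y i t - G z i t = (Dm - d i t) * (pos (y i t) - pos (z i t)) +
      \sum_(j < m) a i j t * (pos (y j t) - pos (z j t)) +
      beta i t * (ricker (c i t) (pos (y i (t - r i))) -
        ricker (c i t) (pos (z i (t - r i)))) - Dm * (y i t - z i t).
    under [X in _ = _ + X + _ - _]eq_bigr do rewrite mulrBr.
    by rewrite sumrB /G; ring.
  move: h1 h2 h3 h4; rewrite !ler_norml; lra.
- move=> i t; have p1 : pos 1 = 1 by rewrite /pos max_l.
  rewrite /G p1 !mulr1.
  have h2 : 0 <= \sum_(j < m) a i j t <= \sum_(j < m) Am.
    apply/andP; split; first by apply: sumr_ge0 => j _; have /andP[] := ab i j t.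
    by apply: ler_sum => j _; have /andP[] := ab i j t.
  have h3 : 0 <= beta i t * ricker (c i t) 1 <= Bm.
    have /andP[b0 b1] := bb i t.
    rewrite mulr_ge0 ?ricker_ge0//= -[leRHS]mulr1; apply: ler_pM => //.
      exact: ricker_ge0.
    exact: ricker_le_id.
  under eq_bigr do rewrite mulr1.
  have := db i t; rewrite ler_norml; lra.
have y_gt0 i t : 0 <= t -> 0 < y i t.
  move=> t0.
  suff : y i 0 * expR (Dm * 0) <= y i t * expR (Dm * t).
    rewrite y1// mulr0 expR0 mulr1 => h.
    by rewrite -(pmulr_lgt0 _ (expR_gt0 (Dm * t))); apply: lt_le_trans h.
  have de (x : R) : is_derive x 1 (fun s => expR (Dm * s)) (expR (Dm * x) * Dm).
    apply: (@is_derive_comp _ (fun s => Dm * s) expR); exact: is_derive_linear.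
  apply: (@nondecreasing_of_derive _ (fun s => y i s * expR (Dm * s))
    (fun s => (G y i s + Dm * y i s) * expR (Dm * s))) => //.
  - apply: continuous_subspaceT => s; apply: cvgM; first exact: cy.
    exact: is_derive_continuous (de s).
  - move=> x /andP[x0 _].
    by apply: is_derive_eq (is_derive_mul _ _ _ _ _ (dy i x x0) (de x)) _; ring.
  - move=> x _; rewrite mulr_ge0 ?expR_ge0// /G subrK.
    have /andP[d0 d1] := db i x; have /andP[b0 _] := bb i x.
    rewrite !addr_ge0 ?mulr_ge0 ?subr_ge0 ?ricker_ge0//.
    by apply: sumr_ge0 => j _; rewrite mulr_ge0//; have /andP[] := ab i j x.
have pos_y i t : pos (y i t) = y i t.
  rewrite /pos max_l//; have [t0|/ltW t0] := leP 0 t; first exact/ltW/y_gt0.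
  by rewrite y1.
exists y; split.
- by move=> i s /andP[_ s0]; exact: y1.
- by move=> i; apply: continuous_subspaceT.
- move=> i t t0; apply: is_derive_eq (dy i t t0) _.
  rewrite nicholson_fieldE /G !pos_y; under eq_bigr do rewrite pos_y.
  by ring.
Qed.
End existence.

(** * Upper bounds for nonnegative solutions *)

Section boundedness.
Context {R : realType} {m : nat}.
Variables (r : 'I_m -> R) (d : 'I_m -> R -> R) (a : 'I_m -> 'I_m -> R -> R).
Variables (beta c : 'I_m -> R -> R) (c0 Bm q del L : R).
Hypotheses (c0_gt0 : 0 < c0) (c_ge : forall i t, c0 <= c i t)
  (beta_bnd : forall i t, 0 <= beta i t <= Bm)
  (q_gt0 : 0 < q) (del_gt0 : 0 < del)
  (col_gt0 : forall i t, 0 <= d i t - \sum_(j < m) a j i t)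
  (recurrent : forall x, exists s, [/\ x <= s, s + del <= x + L &
     forall i u, s <= u <= s + del -> q <= d i u - \sum_(j < m) a j i u]).

(* By the column condition the linear part of the system does not increase the
   total mass, and it decreases it at a fixed rate on recurrent time windows. *)
Lemma nicholson_solution_bounded (y : 'I_m -> R -> R) (T0 : R) :
  (forall i t, T0 <= t -> 0 <= y i t) ->
  (forall i (t : R), T0 <= t ->
    is_derive t 1 (y i) (nicholson_field r d a beta c y i t)) ->
  exists K, forall i t, T0 <= t -> y i t <= K.
Proof.
move=> y0 dy; have c00 := c0_gt0.
pose S t := \sum_(i < m) y i t.
pose dS t := \sum_(i < m) nicholson_field r d a beta c y i t.
(* Since x exp(-c x) <= 1/c, production is bounded independently of the size of the solution. *)
pose B := \sum_(i < m) Bm * c0^-1.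
have dSE t : dS t = \sum_(i < m) - ((d i t - \sum_(j < m) a j i t) * y i t) +
    \sum_(i < m) beta i t * ricker (c i t) (y i (t - r i)).
  rewrite /dS; under eq_bigr do rewrite nicholson_fieldE.
  (* Exchanging the sums collects the coefficient of y_i, which turns row sums of a into the column
     sums of the hypothesis. *)
  rewrite big_split/=; congr (_ + _); rewrite big_split/= exchange_big/=.
  rewrite -big_split/=; apply: eq_bigr => i _.
  by rewrite -mulr_suml; ring.
have RB t : \sum_(i < m) beta i t * ricker (c i t) (y i (t - r i)) <= B.
  apply: ler_sum => i _; have /andP[b0 b1] := beta_bnd i t.
  have ci := c_ge i t; have h : ricker (c i t) (y i (t - r i)) <= c0^-1.
    apply: le_trans (ricker_le_inv _ _ _) _; first lra.
    by rewrite lef_pV2 ?posrE//; lra.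
  apply: le_trans (ler_wpM2l b0 h) _.
  by rewrite ler_wpM2r// invr_ge0 ltW.
have [||||K HK] := @bounded_of_recurrent_decay R S dS T0 B q del L q_gt0 del_gt0.
- apply: sumr_ge0 => i _; have /andP[b0 b1] := beta_bnd i 0.
  by rewrite mulr_ge0 ?invr_ge0//; [exact: le_trans b1|exact: ltW].
- move=> t Tt; rewrite /S.
  have := @is_derive_sum R R R m y t 1 (fun i => nicholson_field r d a beta c y i t)
    (fun i => dy i t Tt).
  by rewrite (_ : \sum_(i < m) y i = S)//; apply/funext => s; rewrite fct_sumE.
- move=> t Tt; rewrite dSE -[leRHS]add0r lerD//.
  apply: sumr_le0 => i _; rewrite oppr_le0 mulr_ge0//.
  exact: y0.
- move=> x; have [s [xs sL H]] := recurrent x; exists s; split=> // u us Tu.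
  rewrite dSE addrC lerD// /S mulr_sumr -sumrN; apply: ler_sum => i _.
  rewrite lerN2 ler_wpM2r//; [exact: y0|exact: H].
exists K => i t Tt; apply: le_trans (HK t Tt).
rewrite /S (bigD1 i)//= lerDl; apply: sumr_ge0 => j _; exact: y0.
Qed.
End boundedness.

(** * Limits of translates along almost periods *)

Section asymptotic_almost_periodicity.
Context {R : realType}.

Lemma exists_nat_ge (x : R) : exists N : nat, x <= N%:R.
Proof. by exists (Num.truncn x).+1; exact/ltW/truncnS_gt. Qed.

Lemma exists_inv_nat_le (eps : R) : 0 < eps ->
  exists N : nat, forall n, (N <= n)%N -> n.+1%:R^-1 <= eps.
Proof.
move=> e0; have [N HN] := exists_nat_ge eps^-1; exists N => n Nn.
rewrite -[eps]invrK lef_pV2 ?posrE ?invr_gt0// (le_trans HN)// ler_nat.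
exact: leqW.
Qed.

Lemma common_period_sub {J : Type} (f : J -> R -> R) (e1 e2 s1 s2 : R) :
  common_period f e1 s1 -> common_period f e2 s2 ->
  common_period f (e1 + e2) (s1 - s2).
Proof.
move=> p1 p2 j t; have h1 := p1 j (t - s2); have := p2 j (t - s2).
rewrite subrK distrC => h2.
rewrite (_ : t + (s1 - s2) = t - s2 + s1); last by ring.
by have := ler_distD (f j (t - s2)) (f j (t - s2 + s1)) (f j t); lra.
Qed.

Lemma common_period_le {J : Type} (f : J -> R -> R) (e1 e2 s : R) : e1 <= e2 ->
  common_period f e1 s -> common_period f e2 s.
Proof. by move=> e12 p j t; apply: lt_le_trans e12; exact: p. Qed.

Definition translates_close {I J : Type} (f : J -> R -> R) (y : I -> R -> R) :=
  forall theta : R, 0 < theta -> exists eps T : R, 0 < eps /\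
    forall s, common_period f eps s ->
    forall i t, T <= t -> T <= t + s -> `|y i (t + s) - y i t| <= theta.

Lemma almost_periodic_limit {I : Type} {J : finType} (f : J -> R -> R)
    (y : I -> R -> R) :
  (forall j, almost_periodic (f j)) -> translates_close f y ->
  exists (u : I -> R -> R) (s : nat -> R),
    [/\ forall n, n%:R <= s n, forall n, common_period f n.+1%:R^-1 (s n),
      forall theta : R, 0 < theta -> exists (N : nat) (T : R), forall n i t,
        (N <= n)%N -> T <= t + s n -> `|y i (t + s n) - u i t| <= theta &
      forall theta : R, 0 < theta -> exists2 eps : R, 0 < eps &
        forall p, common_period f eps p -> forall i t, `|u i (t + p) - u i t| <= theta].
Proof.
move=> apf tc.
have [s Hs] : {s : nat -> R & forall n, n%:R <= s n /\
    common_period f n.+1%:R^-1 (s n)}.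
  apply: (@choice nat R (fun n s => n%:R <= s /\
    common_period f n.+1%:R^-1 s)) => n.
  have n0 : 0 < n.+1%:R^-1 :> R by rewrite invr_gt0.
  have [l _ hl] := common_periods_relatively_dense f _ apf n0.
  by have [p /= fp /andP[np _]] := hl n%:R; exists p.
have cauchy theta : 0 < theta -> exists (N : nat) (T : R), forall n k i t,
    (N <= n)%N -> (N <= k)%N -> T <= t + s n -> T <= t + s k ->
    `|y i (t + s n) - y i (t + s k)| <= theta.
  move=> /tc [eps [T [e0 H]]].
  have e2 : 0 < eps / 2 by rewrite divr_gt0.
  have [N HN] := exists_inv_nat_le _ e2.
  exists N, T => n k i t Nn Nk Tn Tk.
  have p : common_period f eps (s n - s k).
    apply: common_period_le (common_period_sub _ _ _ _ _ (Hs n).2 (Hs k).2).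
    by rewrite (splitr eps) lerD ?HN.
  have := H _ p i (t + s k).
  rewrite (_ : t + s k + (s n - s k) = t + s n); last by ring.
  exact.
have [u Hu] : {u : I * R -> R & forall p, forall eps : R, 0 < eps ->
    exists N, forall n, (N <= n)%N -> `|y p.1 (p.2 + s n) - u p| <= eps}.
  apply: (@choice (I * R)%type R (fun p l => forall eps : R, 0 < eps ->
    exists N, forall n, (N <= n)%N -> `|y p.1 (p.2 + s n) - l| <= eps)) => -[i t] /=.
  apply: (@cauchy_limit R (fun n => y i (t + s n))) => eps /cauchy [N [T H]].
  have [N' HN'] := exists_nat_ge (T - t).
  have big n : (maxn N N' <= n)%N -> (N <= n)%N /\ T <= t + s n.
    rewrite geq_max => /andP[Nn N'n]; split=> //.
    have := (Hs n).1; have : N'%:R <= n%:R :> R by rewrite ler_nat.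
    lra.
  by exists (maxn N N') => n k /big[? ?] /big[? ?]; exact: H.
pose v i t := u (i, t).
(* The second index tends to infinity at fixed t; N and T, taken from the Cauchy property, do not
   depend on t. *)
have unif theta : 0 < theta -> exists (N : nat) (T : R), forall n i t,
    (N <= n)%N -> T <= t + s n -> `|y i (t + s n) - v i t| <= theta.
  move=> /cauchy [N [T H]]; exists N, T => n i t Nn Tn.
  apply/ler_addgt0Pr => eps e0.
  have [N1 HN1] := Hu (i, t) _ e0; have [N2 HN2] := exists_nat_ge (T - t).
  pose k := maxn N (maxn N1 N2).
  have [Nk N1k N2k] : [/\ (N <= k)%N, (N1 <= k)%N & (N2 <= k)%N].
    by rewrite /k !leq_max !leqnn !orbT.
  have Tk : T <= t + s k.
    by have := (Hs k).1; have : N2%:R <= k%:R :> R by [rewrite ler_nat]; lra.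
  have h1 := H n k i t Nn Nk Tn Tk; have /= h2 := HN1 k N1k.
  by have := ler_distD (y i (t + s k)) (y i (t + s n)) (v i t); rewrite /v; lra.
exists v, s; split => //; [by move=> n; exact: (Hs n).1|by move=> n; exact: (Hs n).2|].
move=> theta th0; have th3 : 0 < theta / 3 by rewrite divr_gt0.
have [eps [T [e0 H]]] := tc _ th3; exists eps => // p fp i t.
have [N [T' H']] := unif _ th3.
(* n may depend on t and p: it only has to move both t and t + p beyond the two thresholds, and it
   is absent from the final estimate. *)
have [N1 HN1] := exists_nat_ge (`|T| + `|T'| + `|t| + `|p|).
pose n := maxn N N1.
have [Nn N1n] : (N <= n)%N /\ (N1 <= n)%N by rewrite /n !leq_max !leqnn !orbT.
have sn : `|T| + `|T'| + `|t| + `|p| <= s n.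
  by apply: le_trans (Hs n).1; apply: le_trans HN1 _; rewrite ler_nat.
have [a1 a2] := (ler_norm T, ler_norm T'); have := ler_norm (- t).
have := ler_norm (- p); rewrite !normrN => a3 a4.
have [b1 b2] := (normr_ge0 T, normr_ge0 T'); have [b3 b4] := (normr_ge0 t, normr_ge0 p).
have h1 := H' n i t Nn ltac:(lra); have h2 := H' n i (t + p) Nn ltac:(lra).
have h3 := H p fp i (t + s n) ltac:(lra) ltac:(lra).
rewrite addrAC in h3.
have := ler_distD (y i (t + p + s n)) (v i (t + p)) (v i t).
have := ler_distD (y i (t + s n)) (y i (t + p + s n)) (v i t).
rewrite (distrC (v i (t + p)) (y i (t + p + s n))); lra.
Qed.
End asymptotic_almost_periodicity.

(** * Dependence of the field on the state and on the coefficients *)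

Section field_estimates.
Context {R : realType} {m : nat}.
Variables (r : 'I_m -> R) (d : 'I_m -> R -> R) (a : 'I_m -> 'I_m -> R -> R).
Variables (beta c : 'I_m -> R -> R).

(** All coefficients as one finite family, so that a single s is an almost period of each of
    them. *)
Definition coefficient (k : ('I_m + 'I_m * 'I_m) + ('I_m + 'I_m)) : R -> R :=
  match k with
  | inl (inl i) => d i
  | inl (inr ij) => a ij.1 ij.2
  | inr (inl i) => beta i
  | inr (inr i) => c i
  end.

Variable B : R.
Hypotheses (B_ge0 : 0 <= B) (d_bnd : forall i t, 0 <= d i t <= B)
  (a_bnd : forall i j t, 0 <= a i j t <= B)
  (beta_bnd : forall i t, 0 <= beta i t <= B)
  (c_ge0 : forall i t, 0 <= c i t).

Local Notation F := (nicholson_field r d a beta c).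

Lemma nicholson_field_lipschitz (y z : 'I_m -> R -> R) (e : R) i t :
  (forall j, 0 <= y j (t - r j)) -> (forall j, 0 <= z j (t - r j)) ->
  (forall j, `|y j t - z j t| <= e) ->
  `|y i (t - r i) - z i (t - r i)| <= e ->
  `|F y i t - F z i t| <= (B + \sum_(j < m) B + B) * e.
Proof.
move=> y0 z0 yz yzr.
have h1 : `|d i t * (y i t - z i t)| <= B * e.
  by have /andP[? ?] := d_bnd i t; rewrite normrM ger0_norm// ler_pM.
have h2 : `|\sum_(j < m) a i j t * (y j t - z j t)| <= (\sum_(j < m) B) * e.
  apply: le_trans (ler_norm_sum _ _ _) _; rewrite mulr_suml; apply: ler_sum => j _.
  by have /andP[? ?] := a_bnd i j t; rewrite normrM ger0_norm// ler_pM.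
have h3 : `|beta i t * (ricker (c i t) (y i (t - r i)) -
    ricker (c i t) (z i (t - r i)))| <= B * e.
  have /andP[? ?] := beta_bnd i t; rewrite normrM ger0_norm// ler_pM//.
  by apply: le_trans (ricker_lipschitz _ _ _ _ _ _) _.
have -> : F y i t - F z i t = - (d i t * (y i t - z i t)) +
    \sum_(j < m) a i j t * (y j t - z j t) + beta i t *
    (ricker (c i t) (y i (t - r i)) - ricker (c i t) (z i (t - r i))).
  under [X in _ = _ + X + _]eq_bigr do rewrite mulrBr.
  by rewrite sumrB !nicholson_fieldE; ring.
by move: h1 h2 h3; rewrite !ler_norml; lra.
Qed.

(** The states on both sides are the same and only the coefficients differ. The bound is the defect
    of the translate as an approximate solution. *)
Lemma nicholson_field_translate (y : 'I_m -> R -> R) (e K s : R) i t :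
  common_period coefficient e s -> 0 <= K ->
  (forall j, 0 <= y j (t + s) <= K) -> 0 <= y i (t + s - r i) <= K ->
  `|F y i (t + s) - F (fun j x => y j (x + s)) i t| <=
  (K + \sum_(j < m) K + K + B * (K * K)) * e.
Proof.
move=> cp K0 yK yrK.
have h1 : `|(d i (t + s) - d i t) * y i (t + s)| <= e * K.
  have /andP[? ?] := yK i; rewrite normrM [X in _ * X]ger0_norm// ler_pM//.
  exact/ltW/(cp (inl (inl i))).
have h2 : `|\sum_(j < m) (a i j (t + s) - a i j t) * y j (t + s)| <=
    e * \sum_(j < m) K.
  apply: le_trans (ler_norm_sum _ _ _) _; rewrite mulr_sumr; apply: ler_sum => j _.
  have /andP[? ?] := yK j; rewrite normrM [X in _ * X]ger0_norm// ler_pM//.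
  exact/ltW/(cp (inl (inr (i, j)))).
have /andP[z0 zK] := yrK.
set z := y i (t + s - r i) in z0 zK.
have h3 : `|(beta i (t + s) - beta i t) * ricker (c i (t + s)) z| <= e * K.
  rewrite normrM [X in _ * X]ger0_norm ?ricker_ge0// ler_pM ?ricker_ge0//.
    exact/ltW/(cp (inr (inl i))).
  by apply: le_trans (ricker_le_id _ _ _ _) _.
have h4 : `|beta i t * (ricker (c i (t + s)) z - ricker (c i t) z)| <=
    B * (e * (K * K)).
  have /andP[? ?] := beta_bnd i t; rewrite normrM ger0_norm// ler_pM//.
  apply: le_trans (ricker_rate_lipschitz _ _ _ _ _ _) _ => //.
  rewrite ler_pM ?mulr_ge0//; first exact/ltW/(cp (inr (inr i))).
  exact: ler_pM.
have -> : F y i (t + s) - F (fun j x => y j (x + s)) i t =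
    - ((d i (t + s) - d i t) * y i (t + s)) +
    \sum_(j < m) (a i j (t + s) - a i j t) * y j (t + s) +
    (beta i (t + s) - beta i t) * ricker (c i (t + s)) z +
    beta i t * (ricker (c i (t + s)) z - ricker (c i t) z).
  under [X in _ = _ + X + _ + _]eq_bigr do rewrite mulrBl.
  rewrite sumrB !nicholson_fieldE (_ : t - r i + s = t + s - r i) -/z; last by ring.
  by ring.
by move: h1 h2 h3 h4; rewrite !ler_norml; lra.
Qed.
End field_estimates.

(** * Almost periodic coefficients: margins, merging and the limit solution *)

Section almost_periodic_nicholson.
Context {R : realType} {m : nat}.
Variables (r : 'I_m -> R) (d : 'I_m -> R -> R) (a : 'I_m -> 'I_m -> R -> R).
Variables (beta c : 'I_m -> R -> R) (d0 c0 : R).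
Hypotheses (r_gt0 : forall i, 0 < r i)
  (ap_d : forall i, almost_periodic (d i))
  (ap_a : forall i j, almost_periodic (a i j))
  (ap_c : forall i, almost_periodic (c i))
  (ap_beta : forall i, almost_periodic (beta i))
  (d0_gt0 : 0 < d0) (d_ge : forall i t, d0 <= d i t)
  (a_ge0 : forall i j t, 0 <= a i j t)
  (beta_gt0 : forall i t, 0 < beta i t)
  (c0_gt0 : 0 < c0) (c_ge : forall i t, c0 <= c i t)
  (col_gt0 : forall i t, 0 < d i t - \sum_(j < m) a j i t)
  (delay_bound : forall i,
     r i * sup (range (fun t : R =>
       beta i t * expR (\int[lebesgue_measure]_(s in `[t - r i, t]) d i s)))
     < expR 1).

Local Notation F := (nicholson_field r d a beta c).
Local Notation coef := (coefficient d a beta c).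

Lemma coefficient_almost_periodic k : almost_periodic (coef k).
Proof. by case: k => [[i|[i j]]|[i|i]] /=. Qed.

Lemma coefficient_bounded : exists2 B : R, 0 < B & [/\
  forall i t, 0 <= d i t <= B, forall i j t, 0 <= a i j t <= B,
  forall i t, 0 <= beta i t <= B & forall i t, c0 <= c i t <= B].
Proof.
have [b Hb] : {b : ('I_m + 'I_m * 'I_m) + ('I_m + 'I_m) -> R &
    forall k t, `|coef k t| <= b k}.
  apply: (@choice _ R (fun k B => forall t, `|coef k t| <= B)) => k.
  have [B _ HB] := almost_periodic_bounded _ (coefficient_almost_periodic k).
  by exists B.
have [B B0 bB] := finite_upper_bound b.
have cB k t : coef k t <= B.
  by apply: le_trans (ler_norm _) _; apply: le_trans (Hb k t) (bB k).
exists B => //; split=> [i t|i j t|i t|i t].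
- rewrite (cB (inl (inl i)) t) andbT; apply: le_trans (d_ge i t); exact: ltW.
- by rewrite (cB (inl (inr (i, j))) t) andbT.
- by rewrite (cB (inr (inl i)) t) andbT ltW.
- by rewrite (cB (inr (inr i)) t) andbT.
Qed.

(** Multiplying r_i sup(...) < e by exp(-1) / r_i gives a positive slack for each i, and finiteness
    of the index set gives a common one. *)
Lemma delay_margin : exists (D : 'I_m -> R -> R) (eta : R), [/\ 0 < eta,
  forall i (t : R), is_derive t 1 (D i) (d i t) &
  forall i t, beta i t * expR (D i t - D i (t - r i)) * expR (-1) <=
    (r i)^-1 - eta].
Proof.
have [B B0 [dB _ bB _]] := coefficient_bounded.
have [D dD] : {D : 'I_m -> R -> R & forall i (t : R), is_derive t 1 (D i) (d i t)}.
  apply: (@choice 'I_m (R -> R) (fun i D => forall t : R,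
    is_derive t 1 D (d i t))) => i.
  by have [D [_ dD]] := primitive_exists _ (ap_d i).1; exists D.
pose f i t := beta i t * expR (D i t - D i (t - r i)).
have fE i t : beta i t * expR (\int[lebesgue_measure]_(s in `[t - r i, t]) d i s) =
    f i t.
  rewrite /f; congr (_ * expR _); apply: Rintegral_primitive => //.
    by rewrite gtrBl.
  exact: (ap_d i).1.
pose S i := sup (range (f i)).
have S_bound i : r i * S i < expR 1.
  have := delay_bound i; rewrite (_ : (fun t => _) = f i)//.
  by apply/funext => t; exact: fE.
have fS i t : f i t <= S i.
  apply: ub_le_sup; last by exists t.
  (* [sup] bounds the values only for a bounded set. Here D i increases by at most B r_i over one
     delay. *)
  exists (B * expR (B * r i)) => _ [x _ <-].
  have /andP[b0 b1] := bB i x; rewrite /f ler_pM ?expR_ge0//.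
  rewrite ler_expR.
  suff : B * (x - r i) - D i (x - r i) <= B * x - D i x by lra.
  apply: (@nondecreasing_of_derive_cc _ (fun s => B * s - D i s)
    (fun s => B - d i s)) => [|s _|s _].
  - by rewrite gerBl ltW.
  - by apply: is_derive_sub; exact: is_derive_linear.
  - by rewrite subr_ge0; have /andP[] := dB i s.
have e1 : 0 < expR (-1) :> R by exact: expR_gt0.
have ee : expR 1 * expR (-1) = 1 :> R by rewrite -expRD subrr expR0.
have [i|eta eta0 Heta] := finite_lower_bound
    (fun i => (r i)^-1 - S i * expR (-1)).
  rewrite subr_gt0 -[ltRHS]mul1r ltr_pdivlMr// -[ltRHS]ee mulrC mulrA.
  by rewrite ltr_pM2r.
exists D, eta; split=> // i t.
have h1 : f i t * expR (-1) <= S i * expR (-1) by rewrite ler_pM2r.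
by have := Heta i; move: h1; rewrite /f; lra.
Qed.

Lemma coefficient_recurrence : exists q del L : R, [/\ 0 < q, 0 < del &
  forall x, exists s, [/\ x <= s, s + del <= x + L & forall i u,
    s <= u <= s + del -> q <= beta i u /\ q <= d i u - \sum_(j < m) a j i u]].
Proof.
have [||q [del [L [q0 del0 H]]]] := @almost_periodic_recurrently_positive R
  ('I_m + 'I_m)%type (fun k => match k with inl i => beta i
    | inr i => fun t => d i t - \sum_(j < m) a j i t end).
- case=> i; [exact: ap_beta|].
  by apply: almost_periodic_sub_sum.
- by case=> i.
exists q, del, L; split=> // x; have [s [xs sL Hs]] := H x.
exists s; split=> // i u us; split; first exact: (Hs (inl i)).
exact: (Hs (inr i)).
Qed.

Lemma approximate_solutions_merge : exists rb : R, [/\ 0 < rb,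
  forall i, r i <= rb & forall M K theta : R, 0 < M -> 0 < K -> 0 < theta ->
  exists eps T : R, [/\ 0 < eps, 0 <= T & forall t0 y dy z dz,
    approximate_solution r d a beta c rb eps M K t0 y dy ->
    approximate_solution r d a beta c rb eps M K t0 z dz ->
    forall i t, t0 + T <= t -> `|y i t - z i t| <= theta]].
Proof.
have [B B0 [dB aB bB cB]] := coefficient_bounded.
have [D [eta [eta0 dD deta]]] := delay_margin.
have [q [del [L [q0 del0 rec]]]] := coefficient_recurrence.
have [r1 r10 rr1] := finite_upper_bound r.
have [r2 r20 rr2] := finite_upper_bound (fun i => (r i)^-1).
pose rb := r1 + r2; have rb0 : 0 < rb by exact: addr_gt0.
have rrb i : r i <= rb by have := rr1 i; rewrite /rb; lra.
have rVrb i : (r i)^-1 <= rb by apply: le_trans (rr2 i) _; rewrite lerDr ltW.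
exists rb; split=> // M K theta M0 K0 th0.
have c00 := c0_gt0.
(* The comparison, applied in both directions, gives a relative error; for states below K it becomes
   the absolute error theta. *)
pose th := Num.min 1 (theta / K).
have thth : 0 < th by rewrite lt_min ltr01 divr_gt0.
have th1 : th <= 1 by rewrite ge_min lexx.
have thK : th * K <= theta by rewrite -ler_pdivlMr// ge_min lexx orbT.
have rec' x : exists s, [/\ x <= s, s + del <= x + L &
    forall i u, s <= u <= s + del -> q <= beta i u].
  have [s [s1 s2 Hs]] := rec x; exists s; split=> // i u us.
  by have [] := Hs i u us.
have [eps [T [eps0 T0 H]]] := @comparison R m r d a beta c D rb B B B B c0 eta q
  del L r_gt0 rrb rVrb dB aB bB cB c00 rb0 dD (ltW B0) (ltW B0) eta0
  deta q0 del0 rec' M K th M0 K0 thth th1.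
exists eps, T; split=> // t0 y dy z dz soly solz i t tt.
have h1 := H t0 y dy z dz soly solz i t tt.
have h2 := H t0 z dz y dy solz soly i t tt.
have t0t : t0 <= t by lra.
have /andP[yM yK] := soly.1 i t t0t; have /andP[zM zK] := solz.1 i t t0t.
have h3 : th * z i t <= th * K by rewrite ler_pM2l.
have h4 : th * y i t <= th * K by rewrite ler_pM2l.
by rewrite ler_norml; lra.
Qed.

Lemma solution_eventually_bounded (phi y : 'I_m -> R -> R) (M t1 : R) :
  nicholson_solution_from r d a beta c phi y -> 0 < M ->
  (forall t i, t1 <= t -> M <= y i t) ->
  exists K T0 : R, [/\ 0 < K, 0 < T0 & forall i t, T0 <= t ->
    M <= y i t <= K /\ is_derive t 1 (y i) (F y i t)].
Proof.
move=> [_ _ dy] M0 yM.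
have [B B0 [dB aB bB cB]] := coefficient_bounded.
have [q [del [L [q0 del0 rec]]]] := coefficient_recurrence.
have rec' x : exists s, [/\ x <= s, s + del <= x + L &
    forall i u, s <= u <= s + del -> q <= d i u - \sum_(j < m) a j i u].
  have [s [s1 s2 Hs]] := rec x; exists s; split=> // i u us.
  by have [] := Hs i u us.
pose T0 := Num.max t1 1.
have T00 : 0 < T0 by rewrite lt_max ltr01 orbT.
have T0t1 t : T0 <= t -> t1 <= t by rewrite ge_max => /andP[].
have col_ge0 i t : 0 <= d i t - \sum_(j < m) a j i t by exact: ltW.
have [||K HK] := @nicholson_solution_bounded R m r d a beta c c0 B q del L c0_gt0
  c_ge bB q0 del0 col_ge0 rec' y T0.
- by move=> i t /T0t1 tt; apply: le_trans (yM t i tt); exact: ltW.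
- by move=> i t Tt; apply: dy; exact: lt_le_trans Tt.
exists (`|K| + 1), T0; split=> // i t Tt.
split; last by apply: dy; exact: lt_le_trans Tt.
rewrite yM ?T0t1//=; apply: le_trans (HK i t Tt) _.
by apply: le_trans (ler_norm _) _; rewrite lerDl.
Qed.

Lemma exact_solution_approximate (y : 'I_m -> R -> R) (rb eps M K t0 : R) :
  0 <= eps -> 0 <= rb ->
  (forall i t, t0 <= t -> M <= y i t <= K /\ is_derive t 1 (y i) (F y i t)) ->
  approximate_solution r d a beta c rb eps M K t0 y (F y).
Proof.
move=> e0 rb0 H; split=> i t tt; first by have [] := H i t tt.
by rewrite subrr normr0; split=> //; have [] := H i t ltac:(lra).
Qed.

(** A forward translate by an (eps / kap)-almost period has defect at most eps and keeps the bounds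
    from the same time t0 on, so it merges with y within a time independent of s. *)
Lemma solution_translates_close (y : 'I_m -> R -> R) (M K t0 : R) :
  0 < M -> 0 < K ->
  (forall i t, t0 <= t -> M <= y i t <= K /\ is_derive t 1 (y i) (F y i t)) ->
  translates_close coef y.
Proof.
move=> M0 K0 soly theta th0.
have [B B0 [dB aB bB cB]] := coefficient_bounded.
have [rb [rb0 rrb merge]] := approximate_solutions_merge.
have [eps [T [eps0 T0 H]]] := merge M K theta M0 K0 th0.
pose kap := K + \sum_(j < m) K + K + B * (K * K).
have S0 : 0 <= \sum_(j < m) K by apply: sumr_ge0 => *; exact: ltW.
have BK0 : 0 <= B * (K * K) by rewrite !mulr_ge0// ltW.
have kap0 : 0 < kap by rewrite /kap; lra.
have cge0 i t : 0 <= c i t by apply: le_trans (c_ge i t); exact: ltW.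
have ypos s : 0 <= s -> common_period coef (eps / kap) s ->
    forall i t, t0 + T <= t -> `|y i (t + s) - y i t| <= theta.
  move=> s0 cs i t tt.
  apply: (H t0 (fun i t => y i (t + s)) (fun i t => F y i (t + s)) y (F y)) => //.
    split=> j x xt; first by have [] := soly j (x + s) ltac:(lra).
    split.
      apply: is_derive_comp_shift.
      by have [] := soly j (x + s) ltac:(lra).
    rewrite -[leRHS](divfK (lt0r_neq0 kap0)) [leRHS]mulrC.
    apply: (@nicholson_field_translate R m r d a beta c B bB cge0) => //.
    - exact: ltW.
    - move=> k; have [/andP[? ?] _] := soly k (x + s) ltac:(lra).
      by apply/andP; split; lra.
    - have rj := rrb j; have [/andP[? ?] _] := soly j (x + s - r j) ltac:(lra).
      by apply/andP; split; lra.
  by apply: exact_solution_approximate => //; exact: ltW.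
exists (eps / kap), (t0 + T); split; first exact: divr_gt0.
move=> s cs i t tt tts.
(* For negative s the roles are exchanged: -s is an almost period too, and the forward case is used
   at time t + s. *)
have [s0|/ltW s0] := leP 0 s; first exact: ypos.
rewrite distrC.
have csN : common_period coef (eps / kap) (- s).
  move=> k x; have := cs k (x - s); rewrite subrK distrC.
  exact.
by have := ypos (- s) ltac:(lra) csN i (t + s) tts; rewrite addrK.
Qed.

(** Uniform convergence of translates says nothing about derivatives, so the limit is taken in the
    integrated equation, which needs continuity of u first. *)
Lemma almost_periodic_solution_exists (y : 'I_m -> R -> R) (M K t0 : R) :
  0 < M -> 0 < K ->
  (forall i t, t0 <= t -> M <= y i t <= K /\ is_derive t 1 (y i) (F y i t)) ->
  exists u : 'I_m -> R -> R, [/\ nicholson_entire_solution r d a beta c u,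
    forall i, almost_periodic (u i) & forall i t, M <= u i t <= K].
Proof.
move=> M0 K0 soly.
have [B B0 [dB aB bB cB]] := coefficient_bounded.
have [rb rb0 rrb] := finite_upper_bound r.
have cge0 i t : 0 <= c i t by apply: le_trans (c_ge i t); exact: ltW.
have [u [s [sn sper lim uper]]] := almost_periodic_limit coef y
  coefficient_almost_periodic (solution_translates_close y M K t0 M0 K0 soly).
have limK i t theta : 0 < theta -> exists n, `|y i (t + s n) - u i t| <= theta /\
    M <= y i (t + s n) <= K.
  move=> /lim [N [T H]]; have [N1 HN1] := exists_nat_ge (`|T - t| + `|t0 - t|).
  pose n := maxn N N1.
  have [Nn N1n] : (N <= n)%N /\ (N1 <= n)%N by rewrite /n !leq_max !leqnn !orbT.
  have snt : `|T - t| + `|t0 - t| <= s n.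
    by apply: le_trans (sn n); apply: le_trans HN1 _; rewrite ler_nat.
  have [a1 a2] := (ler_norm (T - t), ler_norm (t0 - t)).
  have [b1 b2] := (normr_ge0 (T - t), normr_ge0 (t0 - t)).
  exists n; split; first by apply: H => //; lra.
  by have [] := soly i (t + s n) ltac:(lra).
have uMK i t : M <= u i t <= K.
  apply/andP; split; apply/ler_addgt0Pr => theta th0;
    have [n [+ /andP[yM yK]]] := limK i t _ th0; rewrite ler_norml; lra.
have cu i : continuous (u i).
  move=> t; apply/cvgrPdist_le => eps e0.
  have e3 : 0 < eps / 3 by rewrite divr_gt0.
  have [N [T H]] := lim _ e3.
  have [N1 HN1] := exists_nat_ge (`|T - t| + `|t0 - t| + 1).
  pose n := maxn N N1.
  have [Nn N1n] : (N <= n)%N /\ (N1 <= n)%N by rewrite /n !leq_max !leqnn !orbT.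
  have snt : `|T - t| + `|t0 - t| + 1 <= s n.
    by apply: le_trans (sn n); apply: le_trans HN1 _; rewrite ler_nat.
  have [a1 a2] := (ler_norm (T - t), ler_norm (t0 - t)).
  have [b1 b2] := (normr_ge0 (T - t), normr_ge0 (t0 - t)).
  have cy : {for t, continuous (fun x => y i (x + s n))}.
    apply: (@is_derive_continuous _ _ _ (F y i (t + s n))).
    apply: is_derive_comp_shift.
    by have [] := soly i (t + s n) ltac:(lra).
  near=> x.
  have h1 : `|y i (t + s n) - y i (x + s n)| <= eps / 3.
    by near: x; move/cvgrPdist_le : cy; apply.
  have xt : `|t - x| < 1 by near: x; apply/nbhs_normP; exists 1 => //=.
  have h2 := H n i t Nn ltac:(lra).
  have h3 : `|y i (x + s n) - u i x| <= eps / 3.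
    by apply: H => //; move: xt; rewrite ltr_norml; lra.
  have := ler_distD (y i (t + s n)) (u i t) (u i x).
  have := ler_distD (y i (x + s n)) (y i (t + s n)) (u i x).
  by rewrite (distrC (u i t) (y i (t + s n))); lra.
exists u; split => // [i|i]; last first.
  apply: (@almost_periodic_of_common_periods R _ coef) => //.
    exact: coefficient_almost_periodic.
  move=> eps e0; have e2 : 0 < eps / 2 by rewrite divr_gt0.
  have [e' e'0 H] := uper _ e2; exists e' => // p cp t.
  by have := H p cp i t; lra.
have cF : continuous (F u i).
  rewrite (_ : F u i = fun t => - d i t * u i t + \sum_(j < m) a i j t * u j t +
    beta i t * ricker (c i t) (u i (t - r i))); last first.
    by apply/funext => t; exact: nicholson_fieldE.
  move=> t; apply: cvgD; first apply: cvgD.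
  - by apply: cvgM; [apply: cvgN; exact: (ap_d i).1|exact: cu].
  - apply: continuous_sum => j x.
    by apply: cvgM; [exact: (ap_a i j).1|exact: cu].
  - apply: cvgM; first exact: (ap_beta i).1.
    apply: (@continuous_ricker R (c i) (fun x => u i (x - r i))).
      exact: (ap_c i).1.
    exact: continuous_translate.
have [U [_ dU]] := primitive_exists _ cF.
pose kap := K + \sum_(j < m) K + K + B * (K * K).
pose lip := B + \sum_(j < m) B + B.
have kap0 : 0 < kap.
  have : 0 <= \sum_(j < m) K by apply: sumr_ge0 => *; exact: ltW.
  have : 0 <= B * (K * K) by rewrite !mulr_ge0// ltW.
  by rewrite /kap; lra.
have lip0 : 0 < lip.
  have : 0 <= \sum_(j < m) B by apply: sumr_ge0 => *; exact: ltW.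
  by rewrite /lip; lra.
(* For large n, y (. + s n) - U has derivative at most (kap + lip) theta: [kap] accounts for the
   translated coefficients, [lip] for replacing the translate of y by u. *)
have increment x1 x2 : x1 <= x2 -> u i x2 - u i x1 = U x2 - U x1.
  move=> x12; apply/eqP; rewrite -subr_eq0 -normr_le0; apply/ler_addgt0Pr => eps e0.
  rewrite add0r.
  have den0 : 0 < (kap + lip) * (x2 - x1) + 2.
    by rewrite ltr_wpDl// mulr_ge0 ?subr_ge0// addr_ge0// ltW.
  (* Chosen so that the derivative error over [x1, x2] and the errors theta at the two endpoints add
     up to eps. *)
  pose theta := eps / ((kap + lip) * (x2 - x1) + 2).
  have th0 : 0 < theta by exact: divr_gt0.
  have [N [T H]] := lim _ th0; have [N2 HN2] := exists_inv_nat_le _ th0.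
  have [N1 HN1] := exists_nat_ge (`|T - x1| + `|t0 - x1| + rb).
  pose n := maxn N (maxn N1 N2).
  have [Nn N1n N2n] : [/\ (N <= n)%N, (N1 <= n)%N & (N2 <= n)%N].
    by rewrite /n !leq_max !leqnn !orbT.
  have snt : `|T - x1| + `|t0 - x1| + rb <= s n.
    by apply: le_trans (sn n); apply: le_trans HN1 _; rewrite ler_nat.
  have [a1 a2] := (ler_norm (T - x1), ler_norm (t0 - x1)).
  have [b1 b2] := (normr_ge0 (T - x1), normr_ge0 (t0 - x1)).
  have yn x : x1 - rb <= x -> forall j, 0 <= y j (x + s n) <= K /\
      `|y j (x + s n) - u j x| <= theta.
    move=> xx j; split; last by apply: H => //; lra.
    by have [/andP[? ?] _] := soly j (x + s n) ltac:(lra); apply/andP; split; lra.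
  have Fclose x : x1 <= x -> `|F y i (x + s n) - F u i x| <= (kap + lip) * theta.
    move=> xx.
    have xr j : x1 - rb <= x - r j by have := rrb j; lra.
    have xx' : x1 - rb <= x by lra.
    have h1 : `|F y i (x + s n) - F (fun j x => y j (x + s n)) i x| <= kap * theta.
      apply: (@nicholson_field_translate R m r d a beta c B bB cge0) => //.
      - by apply: common_period_le (sper n); exact: HN2.
      - exact: ltW.
      - by move=> j; have [] := yn x xx' j.
      - rewrite (_ : x + s n - r i = x - r i + s n); last by ring.
        by have [] := yn _ (xr i) i.
    have h2 : `|F (fun j x => y j (x + s n)) i x - F u i x| <= lip * theta.
      apply: (@nicholson_field_lipschitz R m r d a beta c B dB aB bB cge0).
      - by move=> j; have [/andP[]] := yn _ (xr j) j.
      - by move=> j; have /andP[? _] := uMK j (x - r j); lra.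
      - by move=> j; have [] := yn x xx' j.
      - by have [] := yn _ (xr i) i.
    have := ler_distD (F (fun j x => y j (x + s n)) i x) (F y i (x + s n)) (F u i x).
    lra.
  pose E := (kap + lip) * theta.
  have dh x : x1 <= x <= x2 -> is_derive x 1 (fun x => y i (x + s n) - U x)
      (F y i (x + s n) - F u i x).
    move=> /andP[xx _].
    have dy : is_derive x 1 (fun x => y i (x + s n)) (F y i (x + s n)).
      apply: is_derive_comp_shift.
      by have [] := soly i (x + s n) ltac:(lra).
    exact: is_derive_sub.
  have up : E * x1 - (y i (x1 + s n) - U x1) <= E * x2 - (y i (x2 + s n) - U x2).
    apply: (@nondecreasing_of_derive_cc _ (fun x => E * x - (y i (x + s n) - U x))
      (fun x => E - (F y i (x + s n) - F u i x)) x1 x2 x12) => x xx.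
      by apply: is_derive_sub (dh x xx); exact: is_derive_linear.
    have /andP[x1x _] := xx; rewrite subr_ge0.
    exact: le_trans (ler_norm _) (Fclose x x1x).
  have lo : E * x1 + (y i (x1 + s n) - U x1) <= E * x2 + (y i (x2 + s n) - U x2).
    apply: (@nondecreasing_of_derive_cc _ (fun x => E * x + (y i (x + s n) - U x))
      (fun x => E + (F y i (x + s n) - F u i x)) x1 x2 x12) => x xx.
      by apply: is_derive_add (dh x xx); exact: is_derive_linear.
    have /andP[x1x _] := xx.
    by have := Fclose x x1x; rewrite -/E ler_norml; lra.
  have [_ c1] := yn x1 ltac:(lra) i; have [_ c2] := yn x2 ltac:(lra) i.
  have epsE : E * (x2 - x1) + 2 * theta = eps.
    rewrite /E /theta; rewrite -[RHS](divfK (lt0r_neq0 den0)); ring.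
  move: c1 c2; rewrite !ler_norml; lra.
move=> t.
have uE : u i = fun x => U x + (u i 0 - U 0).
  apply/funext => x; have [x0|/ltW x0] := leP 0 x.
    by have := increment 0 x x0; lra.
  by have := increment x 0 x0; lra.
rewrite uE -[F u i t]addr0; apply: is_derive_add.
Unshelve. all: by end_near. Qed.
End almost_periodic_nicholson.

(** * Existence, uniqueness and attraction *)

Theorem theorem4p7 (R : realType) (m : nat) (r : 'I_m -> R)
    (d : 'I_m -> R -> R) (a : 'I_m -> 'I_m -> R -> R)
    (beta c : 'I_m -> R -> R) (d0 c0 : R)
    (r_gt0 : forall i, 0 < r i)
    (a1_d : forall i, almost_periodic (d i))
    (a1_a : forall i j, almost_periodic (a i j))
    (a1_c : forall i, almost_periodic (c i))
    (a1_beta : forall i, almost_periodic (beta i))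
    (d0_gt0 : 0 < d0)
    (a2 : forall i t, d0 <= d i t)
    (a3_ge0 : forall i j t, 0 <= a i j t)
    (a3_diag : forall i t, a i i t = 0)
    (a4 : forall i t, 0 < beta i t)
    (c0_gt0 : 0 < c0)
    (a5 : forall i t, c0 <= c i t)
    (a6 : forall i t, 0 < d i t - \sum_(j < m) a j i t)
    (persistent : uniformly_persistent_at_0 r d a beta c)
    (delay_bound : forall i,
       r i * sup (range (fun t : R =>
         beta i t * expR (\int[lebesgue_measure]_(s in `[t - r i, t]) d i s)))
       < expR 1) :
  exists ystar : 'I_m -> R -> R,
    [/\ positive_almost_periodic_solution r d a beta c ystar,
        forall z : 'I_m -> R -> R,
          positive_almost_periodic_solution r d a beta c z ->
          forall i t, z i t = ystar i t
      & forall phi : 'I_m -> R -> R, admissible_initial_map r phi ->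
        forall y : 'I_m -> R -> R, nicholson_solution_from r d a beta c phi y ->
        forall i, y i t - ystar i t @[t --> +oo] --> (0 : R)].
Proof.
have [M M0 persists] := persistent.
have [B B0 [dB aB bB cB]] :=
  coefficient_bounded d a beta c d0 c0 a1_d a1_a a1_c a1_beta d0_gt0 a2 a3_ge0 a4 a5.
have cge0 i t : 0 <= c i t by apply: le_trans (a5 i t); exact: ltW.
have eventually phi y : admissible_initial_map r phi ->
    nicholson_solution_from r d a beta c phi y ->
    exists K T0 : R, [/\ 0 < K, 0 < T0 & forall i t, T0 <= t ->
      M <= y i t <= K /\ is_derive t 1 (y i) (nicholson_field r d a beta c y i t)].
  move=> adm sol; have [t1 yM] := persists phi adm y sol.
  exact: (@solution_eventually_bounded R m r d a beta c d0 c0) sol M0 yM.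
(* One admissible solution is enough as a source of translates; the history 1 is the simplest
   choice. *)
have [y sol] : exists y, nicholson_solution_from r d a beta c (fun _ _ => 1) y.
  apply: (@nicholson_solution_exists R m r d a beta c B B B) => //; try exact: ltW.
  - by move=> i; exact: (a1_d i).1.
  - by move=> i j; exact: (a1_a i j).1.
  - by move=> i; exact: (a1_beta i).1.
  - by move=> i; exact: (a1_c i).1.
have adm1 : admissible_initial_map r (fun _ _ => 1).
  by split=> // i; apply: continuous_subspaceT => x; exact: cvg_cst.
have [K [T0 [K0 T00 soly]]] := eventually _ _ adm1 sol.
have [u [entire ap_u uMK]] := @almost_periodic_solution_exists R m r d a beta c
  d0 c0 r_gt0 a1_d a1_a a1_c a1_beta d0_gt0 a2 a3_ge0 a4 c0_gt0 a5 a6 delay_bound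
  y M K T0 M0 K0 soly.
have attracts phi z : admissible_initial_map r phi ->
    nicholson_solution_from r d a beta c phi z ->
    forall i, z i t - u i t @[t --> +oo] --> (0 : R).
  move=> adm solz i; have [K' [T' [K'0 T'0 zMK]]] := eventually _ _ adm solz.
  have [rb [rb0 rrb merge]] := @approximate_solutions_merge R m r d a beta c
    d0 c0 r_gt0 a1_d a1_a a1_c a1_beta d0_gt0 a2 a3_ge0 a4 c0_gt0 a5 a6 delay_bound.
  apply/cvgrPdist_le => eps e0.
  (* The lower bound M is common to all solutions, but the upper bound depends on the solution; K +
     K' serves both. *)
  have KK0 : 0 < K + K' by exact: addr_gt0.
  have [e [T [e00 _ H]]] := merge M (K + K') eps M0 KK0 e0.
  exists (T' + T); split; first exact: num_real.
  move=> t /ltW tT; rewrite /= sub0r normrN.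
  apply: (H T' _ (nicholson_field r d a beta c z) _
    (nicholson_field r d a beta c u)) => //.
    apply: exact_solution_approximate; [exact: ltW|exact: ltW|].
    move=> j x xT; have [/andP[zM zK] dz] := zMK j x xT.
    by split=> //; rewrite zM (le_trans zK)// lerDr ltW.
  apply: exact_solution_approximate; [exact: ltW|exact: ltW|].
  move=> j x _; have /andP[uM uK] := uMK j x.
  by split; [rewrite uM (le_trans uK)// lerDl ltW|exact: entire].
exists u; split; last by move=> phi adm z; exact: attracts.
- by split=> // i t; have /andP[uM _] := uMK i t; exact: lt_le_trans uM.
- move=> z [entz ap_z z0] i t.
  have cz j : continuous (z j).
    by move=> x; exact: is_derive_continuous (entz j x).
  suff -> : z i = u i by [].
  apply: almost_periodic_unique_asymptotic => //.
  (* An entire positive solution is the solution issued from its own restriction, so it is attracted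
     as well. *)
  apply: (attracts z); split=> //.
  + by move=> j; exact: continuous_subspaceT.
  + by move=> j s _; exact: ltW.
  + by move=> j; exact: continuous_subspaceT.
Qed.
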